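(* Let $G(n,p)$ be an Erdős–Rényi random graph on $n$ vertices with $p=\lambda/n$, where $\lambda=\lambda_n>1$ remains bounded away from $1$ as $n\to\infty$ (i.e. $\liminf_n \lambda_n>1$). Let $C_{\mathrm{giant}}$ denote its largest connected component, and let $h(n)$ be an arbitrary sequence with $h(n)\to\infty$. Then: (1) If $\lambda\le \ln(n)/8+\ln(\ln(n))-h(n)$, then with probability tending to one as $n\to\infty$, $C_{\mathrm{giant}}$ admits a cospectral mate. (2) If $\lambda\le \ln(n)/10+\ln(\ln(n))-h(n)$, then with probability tending to one as $n\to\infty$, $C_{\mathrm{giant}}$ admits an $\mathbb{R}$-cospectral mate.
   Context: Graphs are finite and simple. A cospectral mate of a graph $G$ is a graph not isomorphic to $G$ whose adjacency matrix has the same spectrum (eigenvalues with multiplicity) as that of $G$. Two graphs are $\mathbb{R}$-cospectral if they are non-isomorphic, cospectral, and their complement graphs are also cospectral; an $\mathbb{R}$-cospectral mate of $G$ is a graph $\mathbb{R}$-cospectral to $G$. In $G(n,p)$ each of the $\binom n2$ possible edges is present independently with probability $p$. *)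

(* Defs.v *)
From HB Require Import structures.
From mathcomp Require Import all_boot all_order all_algebra.
From mathcomp Require Import algC.
From mathcomp Require Import all_classical all_reals all_analysis.
Set Implicit Arguments. Unset Strict Implicit. Unset Printing Implicit Defensive.
Import Order.TTheory GRing.Theory Num.Theory.

Local Open Scope ring_scope.

Definition simple_graph (T : finType) (e : rel T) : Prop :=
  symmetric e /\ irreflexive e.

Definition adjmx (T : finType) (e : rel T) : 'M[algC]_#|T| :=
  \matrix_(i, j) (e (enum_val i) (enum_val j))%:R.

Definition spectrum (m : nat) (A : 'M[algC]_m) : algC -> nat :=
  fun x => mup x (char_poly A).

Definition cospectral (T T' : finType) (e : rel T) (e' : rel T') : Prop :=
  spectrum (adjmx e) = spectrum (adjmx e').

Definition graph_iso (T T' : finType) (e : rel T) (e' : rel T') : Prop :=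
  exists f : T -> T', bijective f /\ forall x y, e' (f x) (f y) = e x y.

Definition gcompl (T : finType) (e : rel T) : rel T :=
  fun x y => (x != y) && ~~ e x y.

(* A cospectral mate of (T, e): a non-isomorphic simple graph with the same
   spectrum.  Cospectral graphs have the same number of vertices, so it is
   no loss of generality to take its vertex set to be 'I_#|T|. *)
Definition has_cospectral_mate (T : finType) (e : rel T) : Prop :=
  exists e' : rel 'I_#|T|,
    [/\ simple_graph e', ~ graph_iso e e' & cospectral e e'].

Definition has_Rcospectral_mate (T : finType) (e : rel T) : Prop :=
  exists e' : rel 'I_#|T|,
    [/\ simple_graph e', ~ graph_iso e e', cospectral e e'
      & cospectral (gcompl e) (gcompl e')].

Definition is_component (T : finType) (e : rel T) (C : {set T}) : Prop :=
  exists x, C = [set y | connect e x y].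

Definition is_largest_component (T : finType) (e : rel T) (C : {set T}) : Prop :=
  is_component e C /\ forall D, is_component e D -> (#|D| <= #|C|)%N.

Definition induced (T : finType) (e : rel T) (C : {set T}) :
  rel {x : T | x \in C} := fun x y => e (val x) (val y).

(* The Erdos-Renyi model G(n,p): a sample is a choice of a boolean for each
   unordered pair {x,y}, encoded as the pair (x,y) with x < y. *)
Definition upair (n : nat) := {q : 'I_n * 'I_n | (q.1 < q.2)%N}.

Definition gnp_graph (n : nat) (w : {ffun upair n -> bool}) : rel 'I_n :=
  fun x y =>
    if (insub (x, y) : option (upair n)) is Some q then w q
    else if (insub (y, x) : option (upair n)) is Some q then w q
    else false.

Definition gnp_weight (R : realType) (n : nat) (p : R)
  (w : {ffun upair n -> bool}) : R :=
  \prod_(q : upair n) (if w q then p else 1 - p).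

Definition gnp_prob (R : realType) (n : nat) (p : R) (P : rel 'I_n -> Prop) : R :=
  \sum_(w : {ffun upair n -> bool})
     (if `[< P (gnp_graph w) >] then gnp_weight p w else 0).

(* "The largest component C_giant admits a cospectral mate": every component
   of maximum size admits one (w.h.p. the maximum component is unique). *)
Definition giant_has_mate (n : nat) (e : rel 'I_n) : Prop :=
  forall C, is_largest_component e C -> has_cospectral_mate (@induced _ e C).

Definition giant_has_Rmate (n : nat) (e : rel 'I_n) : Prop :=
  forall C, is_largest_component e C -> has_Rcospectral_mate (@induced _ e C).

(* Main.v *)
Require Import Defs.
From HB Require Import structures.
From mathcomp Require Import all_boot all_order all_algebra.
From mathcomp Require Import algC.
From mathcomp Require Import all_classical all_reals all_analysis.
From mathcomp Require Import all_fingroup zify ring lra.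
From mathcomp Require Import fintype finset.
Set Implicit Arguments. Unset Strict Implicit. Unset Printing Implicit Defensive.
Import Order.TTheory GRing.Theory Num.Theory numFieldNormedType.Exports.

(** A limb is a rooted tree whose k non-root vertices hang from a vertex u of the
    graph and have no other neighbours.  If (A, B) is a pair of limbs related by
    a rational orthogonal matrix Q that intertwines the two trees and maps one
    attachment vector to the other, then replacing A by B conjugates the whole
    adjacency matrix by diag(1, Q); if moreover Q fixes the all-ones vector, the
    complements are conjugate too.  Schwenk's pair gives k = 8, and k = 10 is
    possible with the extra condition.  The two graphs are told apart by their
    numbers of walks through vertices of degrees 1, 2, 2, 2, which avoid u because
    u has degree at least 3.

    It remains to find a limb A in the giant component.
    - Every component is of size at most s only with small probability: in that event
      the union W of the components of 0, ..., j-1 has between s and 2 s vertices for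
      some j, it is closed, and its other vertices have breadth-first parents in W.
      A union bound over W and the parents converges since x e^(1-x) < 1 for x > 1.
    - A component of linear size without limb is unlikely: planting a limb at one of
      its vertices turns G(n, p) into G(n + k, p) at the cost of a factor
      p^k (1 - p)^(k n + O(1)), and in a given graph each component contains only
      boundedly many limbs that can have been planted in this way.  Double counting
      gives a probability O(1 / (n lambda^k e^(-k lambda))), which tends to 0
      in the range lambda <= ln n / k + ln ln n - h. *)

(** * Pendant trees *)

Lemma card_bigcup_leq (I T : finType) (P : pred I) (F : I -> {set T}) :
  #|\bigcup_(i | P i) F i| <= \sum_(i | P i) #|F i|.
Proof.
elim/big_ind2: _ => [|A a B b Aa Bb|//]; first by rewrite cards0.
exact: leq_trans (leq_card_setU _ _) (leq_add Aa Bb).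
Qed.

(* A rooted tree with [size t] non-root vertices is encoded by its parent list:
   [nth 0 t i] is 0 if vertex i is a child of the root and [j.+1] if it is a child of
   vertex j.  Well-formedness says [j < i]. *)
Definition wf_tree (t : seq nat) : bool :=
  [forall i : 'I_(size t), nth 0 t i <= i].

Definition tadj (t : seq nat) (i j : nat) : bool :=
  (nth 0 t i == j.+1) || (nth 0 t j == i.+1).

Definition troot (t : seq nat) (i : nat) : bool := nth 0 t i == 0.

(** The last clause prescribes the whole neighbourhood of every [f i], so the tree meets the rest of
    the graph only through [u], whose other neighbours are arbitrary. *)
Definition limb (t : seq nat) (T : finType) (e : rel T)
    (f : {ffun 'I_(size t) -> T}) (u : T) : bool :=
  [&& injectiveb f, [forall i, f i != u] &
    [forall i, forall y,
      e (f i) y == (y == u) && troot t i || [exists j, (y == f j) && tadj t i j]]].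

(** Vertices of a limb have degree at most k + 1, so a limb at [u] can only start at such
    neighbours; if they are few, so are the limbs at [u]. *)
Definition small_nbrs (T : finType) (e : rel T) (d : nat) (u : T) : {set T} :=
  [set s | e u s & #|[set y | e s y]| <= d].

(** The root of [f'] counts as one of its vertices, but the root of [f] does not: only the vertices
    [f i] are new when [f] is planted. *)
Definition limb_meets (T : finType) k (f : {ffun 'I_k -> T})
    (f' : {ffun 'I_k -> T}) (u' : T) : bool :=
  [exists i, (f i == u') || [exists j, f i == f' j]].

(* These are the limbs that can have been planted at a vertex of a component without
   limbs: any other limb of the component uses one of the new vertices. *)
Definition lonely (t : seq nat) (D : nat) (T : finType) (e : rel T)
    (f : {ffun 'I_(size t) -> T}) (u : T) : bool :=
  [&& limb e f u, #|small_nbrs e (size t).+1 u| <= D &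
    [forall f' : {ffun 'I_(size t) -> T}, forall u',
      limb e f' u' && connect e u u' ==> limb_meets f f' u']].

Section Limbs.
Variables (t : seq nat) (T : finType) (e : rel T).
Hypothesis wft : wf_tree t.
Hypothesis esym : symmetric e.
Local Notation k := (size t).
Implicit Types (f : {ffun 'I_k -> T}) (u : T).

Lemma wf_treeP (i : 'I_k) : nth 0 t i <= i.
Proof. exact: (forallP wft i). Qed.

Lemma limb_inj f u : limb e f u -> injective f.
Proof. by case/and3P => /injectiveP. Qed.

Lemma limb_root f u i : limb e f u -> f i != u.
Proof. by case/and3P => _ /forallP. Qed.

Lemma limb_adj f u i y : limb e f u ->
  e (f i) y = (y == u) && troot t i || [exists j, (y == f j) && tadj t i j].
Proof. by case/and3P => _ _ /forallP/(_ i)/forallP/(_ y)/eqP. Qed.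

(** The inner default [u] is never reached for a well-formed tree, where the parent index [j] is
    below [i]. *)
Definition tparent f u (i : 'I_k) : T :=
  if nth 0 t i is j.+1 then (if insub j is Some j' then f j' else u) else u.

Lemma tparent_root f u (i : 'I_k) : troot t i -> tparent f u i = u.
Proof. by rewrite /tparent /troot => /eqP ->. Qed.

Lemma tparent_nroot f u (i : 'I_k) : ~~ troot t i ->
  exists2 j : 'I_k, nth 0 t i = j.+1 & tparent f u i = f j.
Proof.
rewrite /tparent /troot; case E: (nth 0 t i) => [//|j] _.
have jk : j < k.
  by have := wf_treeP i; rewrite E => /ltn_trans; apply.
by exists (Ordinal jk); rewrite ?insubT.
Qed.

Lemma tparent_adj f u i : limb e f u -> e (f i) (tparent f u i).
Proof.
move=> L; rewrite (limb_adj _ _ L).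
case: (boolP (troot t i)) => ri; first by rewrite tparent_root // eqxx.
have [j tj ->] := tparent_nroot f u ri.
by apply/orP; right; apply/existsP; exists j; rewrite eqxx /tadj tj eqxx.
Qed.

Lemma limb_deg f u i : limb e f u -> #|[set y | e (f i) y]| <= k.+1.
Proof.
move=> L; apply: (@leq_trans #|u |: f @: setT|).
  apply/subset_leq_card/subsetP => y; rewrite !inE (limb_adj _ _ L).
  case/orP => [/andP[-> //]|/existsP[j /andP[/eqP -> _]]].
  by apply/orP; right; apply: imset_f.
rewrite cardsU1 -add1n leq_add //; first by case: (_ \notin _).
by rewrite -[leqRHS]card_ord -cardsT; apply: leq_imset_card.
Qed.

Lemma limb_connect f u i : limb e f u -> connect e u (f i).
Proof.
move=> L; have [m] := ubnP (i : nat); elim: m i => // m IH i im.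
apply: (@connect_trans _ _ (tparent f u i)); last first.
  by apply: connect1; rewrite esym tparent_adj.
case: (boolP (troot t i)) => ri; first by rewrite tparent_root.
have [j tj ->] := tparent_nroot f u ri.
by apply: IH; have := wf_treeP i; lia.
Qed.

(** One step of a walk that may stay or leave a vertex of degree at most [d]. Vertices of larger
    degree are reached but not left, so a step multiplies the size by at most d + 1. *)
Definition small_step (d : nat) (X : {set T}) : {set T} :=
  X :|: [set y | [exists x in X, e x y && (#|[set z | e x z]| <= d)]].

Lemma small_stepS d (X Y : {set T}) :
  X \subset Y -> small_step d X \subset small_step d Y.
Proof.
move=> XY; apply: setUSS => //; apply/subsetP => y; rewrite !inE.
by case/existsP => x /andP[xX H]; apply/existsP; exists x; rewrite (subsetP XY).
Qed.

Lemma iter_small_stepS d m (X Y : {set T}) :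
  X \subset Y -> iter m (small_step d) X \subset iter m (small_step d) Y.
Proof. by move=> XY; elim: m => //= m; apply: small_stepS. Qed.

Lemma iter_small_step_leq d m m' (X : {set T}) : m <= m' ->
  iter m (small_step d) X \subset iter m' (small_step d) X.
Proof.
move=> /subnKC <-; rewrite addnC iterD.
elim: (m' - m) => //= n IH; apply: subset_trans IH _; exact: subsetUl.
Qed.

Lemma card_small_step d (X : {set T}) : #|small_step d X| <= d.+1 * #|X|.
Proof.
apply: leq_trans (leq_card_setU _ _) _; rewrite mulSn leq_add2l.
pose F x := if #|[set z | e x z]| <= d then [set z | e x z] else set0.
have -> : [set y | [exists x in X, e x y && (#|[set z | e x z]| <= d)]]
    = \bigcup_(x in X) F x.
  apply/setP => y; rewrite inE; apply/existsP/bigcupP.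
    by case=> x /and3P[xX exy dx]; exists x; rewrite // /F dx inE.
  case=> x xX; rewrite /F; case: ifP; rewrite inE // => dx exy.
  by exists x; rewrite xX exy dx.
apply: leq_trans (card_bigcup_leq _ _) _.
rewrite mulnC -sum_nat_const; apply: leq_sum => x _.
by rewrite /F; case: ifP; rewrite ?cards0.
Qed.

Lemma card_iter_small_step d m x :
  #|iter m (small_step d) [set x]| <= d.+1 ^ m.
Proof.
elim: m => [|m IH] /=; first by rewrite cards1.
apply: leq_trans (card_small_step _ _) _.
by rewrite expnS leq_mul2l IH orbT.
Qed.

(** Climbing from [f i] leaves only tree vertices, of degree at most k + 1, and takes at most i + 1
    steps since indices decrease. The walk stops at [u], whose degree is arbitrary. *)
Lemma root_small_step f u i : limb e f u ->
  u \in iter k (small_step k.+1) [set f i].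
Proof.
move=> L.
suff H : u \in iter i.+1 (small_step k.+1) [set f i].
  exact: (subsetP (iter_small_step_leq _ _ (ltn_ord i)) _ H).
have [m] := ubnP (i : nat); elim: m i => // m IH i im.
have P : tparent f u i \in small_step k.+1 [set f i].
  rewrite !inE; apply/orP; right; apply/existsP; exists (f i).
  by rewrite inE eqxx tparent_adj //= (limb_deg _ L).
case: (boolP (troot t i)) => ri.
  rewrite tparent_root // in P.
  exact: (subsetP (@iter_small_step_leq _ 1 i.+1 _ isT) _ P).
have [j tj Ej] := tparent_nroot f u ri.
have ji : j < i by have := wf_treeP i; rewrite tj.
have Hj := IH j (leq_trans ji im).
rewrite iterSr; apply: (subsetP (iter_small_step_leq _ _ ji)).
apply: (subsetP (iter_small_stepS _ _ _) _ Hj).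
by rewrite sub1set -Ej.
Qed.

(* Coordinates of the limbs at a given root: the position of each vertex among the
   boundedly many small neighbours of its parent. *)
Definition small_rank (D : nat) f u : {ffun 'I_k -> 'I_D.+1} :=
  [ffun i => inord (index (f i) (enum (small_nbrs e k.+1 (tparent f u i))))].

(** The coordinates determine the limb: by induction on the index the parent of [f i] is known, and
    [f i] is recovered from its position among the small neighbours of that parent. *)
Lemma card_limbs_root (D : nat) (A : {set {ffun 'I_k -> T}}) u : k.+1 <= D ->
  {in A, forall f, limb e f u} -> #|small_nbrs e k.+1 u| <= D ->
  #|A| <= D.+1 ^ k.
Proof.
move=> kD LA uD.
have memN f i : f \in A -> f i \in small_nbrs e k.+1 (tparent f u i).
  move=> /LA L; rewrite inE (limb_deg _ L) andbT esym; exact: tparent_adj.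
(* The root is covered by hypothesis; any other parent is a tree vertex, of total degree at most k +
   1. *)
have cardN f i : f \in A -> #|small_nbrs e k.+1 (tparent f u i)| <= D.
  move=> fA; case: (boolP (troot t i)) => ri; first by rewrite tparent_root.
  have [j _ ->] := tparent_nroot f u ri.
  apply: leq_trans kD; apply: leq_trans (limb_deg j (LA _ fA)).
  by apply/subset_leq_card/subsetP => y; rewrite !inE => /andP[].
have inj : {in A &, injective (small_rank D ^~ u)}.
  move=> f g fA gA /= /ffunP E; apply/ffunP => i.
  have [m] := ubnP (i : nat); elim: m i => // m IH i im.
  have Epar : tparent f u i = tparent g u i.
    case: (boolP (troot t i)) => ri; first by rewrite !tparent_root.
    have [j tj ->] := tparent_nroot f u ri.
    have [j' tj' ->] := tparent_nroot g u ri.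
    have -> : j' = j by apply: val_inj => /=; have := tj; rewrite tj' => -[].
    apply: IH; have := wf_treeP i; rewrite tj => H; exact: leq_trans H _.
  have := E i; rewrite !ffunE => /(congr1 val) /=.
  have lt h : h \in A -> index (h i) (enum (small_nbrs e k.+1 (tparent h u i))) < D.+1.
    move=> hA; apply: (@leq_trans #|small_nbrs e k.+1 (tparent h u i)|); last first.
      by apply: leqW; apply: cardN.
    by rewrite cardE index_mem mem_enum memN.
  rewrite !inordK ?lt // -Epar => Ei.
  have fi := memN f i fA; have gi := memN g i gA.
  rewrite -mem_enum in fi; rewrite -mem_enum -Epar in gi.
  by rewrite -(nth_index (f i) fi) Ei nth_index.
rewrite -(card_in_imset inj); apply: leq_trans (max_card _) _.
by rewrite card_ffun !card_ord.
Qed.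

(** A vertex of the fixed limb ([k] choices), a root reached from it ([k.+2 ^ k]), a limb at that
    root ([D.+1 ^ k]). *)
Definition lonely_bound (D : nat) : nat :=
  k * k.+2 ^ k * D.+1 ^ k.

(* All lonely limbs of a component meet any fixed one, so their roots are reached from
   its vertices by walks that only leave vertices of small degree. *)
Lemma card_lonely_component (D : nat) x : k.+1 <= D ->
  #|[set fu : {ffun 'I_k -> T} * T |
      lonely D e fu.1 fu.2 & connect e fu.2 x]| <= lonely_bound D.
Proof.
move=> kD; set A := [set _ | _ & _].
have [->|[[f0 u0]]] := set_0Vmem A; first by rewrite cards0.
rewrite inE /= => /andP[/and3P[L0 _ /forallP M0] c0].
pose U := \bigcup_i iter k (small_step k.+1) [set f0 i].
have AU fu : fu \in A -> fu.2 \in U.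
  rewrite inE => /andP[/and3P[L _ _] c].
  have c' : connect e u0 fu.2.
    by apply: connect_trans c0 _; rewrite (sym_connect_sym esym).
  have := M0 fu.1 => /forallP/(_ fu.2); rewrite L c' /= => /existsP[i].
  case/orP => [/eqP E|/existsP[j /eqP E]]; apply/bigcupP; exists i => //.
    rewrite -E; apply: (subsetP (@iter_small_step_leq k.+1 0 k [set f0 i] isT)).
    by rewrite /= inE.
  by rewrite E; apply: root_small_step.
have -> : A = \bigcup_(u in U) [set fu in A | fu.2 == u].
  apply/setP => fu; apply/idP/bigcupP => [fA|[u _]]; last by rewrite inE => /andP[].
  by exists fu.2; [exact: AU|rewrite inE fA /=].
apply: leq_trans (card_bigcup_leq _ _) _.
apply: (@leq_trans (\sum_(u in U) D.+1 ^ k)); last first.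
  rewrite sum_nat_const leq_mul2r; apply/orP; right.
  apply: leq_trans (card_bigcup_leq _ _) _.
  rewrite -[X in X * _](card_ord k) -sum_nat_const; apply: leq_sum => i _.
  exact: card_iter_small_step.
apply: leq_sum => u _.
set B := [set fu in A | _].
have injB : {in B &, injective (@fst {ffun 'I_k -> T} T)}.
  move=> [f u1] [g u2]; rewrite !inE /= => /andP[_ /eqP ->] /andP[_ /eqP ->].
  by move=> ->.
rewrite -(card_in_imset injB).
have [->|[[f1 u1]]] := set_0Vmem B; first by rewrite imset0 cards0.
rewrite !inE /= => /andP[/andP[/and3P[L1 s1 _] _] /eqP E1]; rewrite E1 in s1.
apply: (@card_limbs_root D _ u) => //.
move=> f /imsetP[[g u2]]; rewrite !inE /= => /andP[/andP[/and3P[L2 _ _] _] /eqP <-].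
by move=> ->.
Qed.

End Limbs.

(** * Invariance under isomorphism *)

Section Isomorphism.
Variables (T T' : finType) (e : rel T) (e' : rel T') (g : T -> T') (h : T' -> T).
Hypotheses (gK : cancel g h) (hK : cancel h g).
Hypothesis eg : forall x y, e' (g x) (g y) = e x y.

Lemma limb_iso t (f : {ffun 'I_(size t) -> T}) u :
  limb e f u -> limb e' [ffun i => g (f i)] (g u).
Proof.
move=> L; apply/and3P; split.
- apply/injectiveP => i j; rewrite !ffunE => /(can_inj gK); exact: limb_inj L _ _.
- by apply/forallP => i; rewrite ffunE (can_eq gK) (limb_root _ L).
apply/forallP => i; apply/forallP => y'; rewrite -(hK y') ffunE eg (limb_adj _ _ L).
rewrite (can_eq gK); apply/eqP; congr (_ || _).
by apply: eq_existsb => j; rewrite ffunE (can_eq gK).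
Qed.

Lemma connect_iso x y : connect e x y -> connect e' (g x) (g y).
Proof.
case/connectP => p; elim: p x => [|z p IH] x /=; first by move=> _ ->.
case/andP => exz pz E; apply: connect_trans (IH z pz E).
by apply: connect1; rewrite eg.
Qed.

Lemma nbrs_iso x : [set y | e' (g x) y] = g @: [set y | e x y].
Proof.
apply/setP => y; rewrite inE -(hK y) eg mem_imset ?inE //; exact: can_inj gK.
Qed.

Lemma small_nbrs_iso d x : small_nbrs e' d (g x) = g @: small_nbrs e d x.
Proof.
apply/setP => y; rewrite -(hK y) mem_imset ?inE; last exact: can_inj gK.
by rewrite eg nbrs_iso card_imset //; apply: can_inj gK.
Qed.

End Isomorphism.

Lemma lonely_iso (T T' : finType) (e : rel T) (e' : rel T') (g : T -> T')
    (h : T' -> T) t D (f : {ffun 'I_(size t) -> T}) u :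
  cancel g h -> cancel h g -> (forall x y, e' (g x) (g y) = e x y) ->
  lonely D e f u -> lonely D e' [ffun i => g (f i)] (g u).
Proof.
move=> gK hK eg /and3P[L S /forallP M]; apply/and3P; split.
- exact: (limb_iso gK hK eg L).
- by rewrite (small_nbrs_iso gK hK eg) card_imset //; apply: can_inj gK.
have eh x y : e (h x) (h y) = e' x y by rewrite -eg !hK.
apply/forallP => f'; apply/forallP => u'; apply/implyP => /andP[L' c'].
have := M [ffun i => h (f' i)] => /forallP/(_ (h u')).
rewrite (limb_iso hK gK eh L') /=.
have := connect_iso eh c'; rewrite gK => -> /= /existsP[i H].
apply/existsP; exists i; rewrite ffunE; case/orP: H => [/eqP ->|/existsP[j]].
  by rewrite hK eqxx.
rewrite ffunE => /eqP ->; apply/orP; right; apply/existsP; exists j.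
by rewrite hK.
Qed.

Definition limb_free t (T : finType) (e : rel T) (v : T) : bool :=
  [forall f : {ffun 'I_(size t) -> T}, forall u, ~~ (limb e f u && connect e v u)].

Lemma ord_split n k (P : 'I_(n + k) -> Prop) :
  (forall a, P (lshift k a)) -> (forall i, P (rshift n i)) -> forall x, P x.
Proof. by move=> Pl Pr x; case: (split_ordP x) => j ->. Qed.

(** * Attaching a tree to a vertex *)

Section Plant.
Variables (t : seq nat) (n : nat) (H : rel 'I_n) (v : 'I_n).
Hypothesis wft : wf_tree t.
Hypothesis (Hsym : symmetric H) (Hirr : irreflexive H).
Local Notation k := (size t).

Definition plant : rel 'I_(n + k) := fun x y =>
  match split x, split y with
  | inl a, inl b => H a b
  | inl a, inr i => (a == v) && troot t i
  | inr i, inl a => (a == v) && troot t i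
  | inr i, inr j => tadj t i j
  end.

Lemma split_lshift (a : 'I_n) : split (lshift k a) = inl a.
Proof. exact: (unsplitK (inl a : 'I_n + 'I_k)). Qed.
Lemma split_rshift (i : 'I_k) : split (rshift n i) = inr i.
Proof. exact: (unsplitK (inr i : 'I_n + 'I_k)). Qed.

Lemma plant_ll a b : plant (lshift k a) (lshift k b) = H a b.
Proof. by rewrite /plant !split_lshift. Qed.
Lemma plant_lr a i : plant (lshift k a) (rshift n i) = (a == v) && troot t i.
Proof. by rewrite /plant split_lshift split_rshift. Qed.
Lemma plant_rl i a : plant (rshift n i) (lshift k a) = (a == v) && troot t i.
Proof. by rewrite /plant split_lshift split_rshift. Qed.
Lemma plant_rr i j : plant (rshift n i) (rshift n j) = tadj t i j.
Proof. by rewrite /plant !split_rshift. Qed.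
Let plantE := (plant_ll, plant_lr, plant_rl, plant_rr).

Lemma plant_sym : symmetric plant.
Proof.
elim/ord_split => a; elim/ord_split => b; rewrite !plantE //.
by rewrite /tadj orbC.
Qed.

Lemma plant_irr : irreflexive plant.
Proof.
elim/ord_split => a; rewrite !plantE //.
by rewrite /tadj orbb; have := wf_treeP wft a; lia.
Qed.

(** Every non-root vertex has exactly one edge to its parent; the first sum sees it in both orders,
    and edges to the root are added twice. *)
Lemma tree_edges : \sum_(i < k) \sum_(j < k) (tadj t i j : nat)
   + 2 * \sum_(i < k) (troot t i : nat) = 2 * k.
Proof.
have E (i : 'I_k) : \sum_(j < k) (nth 0 t i == j.+1 : nat) + (troot t i : nat) = 1.
  have := wf_treeP wft i; rewrite /troot; case: (nth 0 t i) => [_|m mi].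
    by rewrite big1.
  have mk : m < k by apply: leq_trans (ltnW (ltn_ord i)); lia.
  rewrite (bigD1 (Ordinal mk)) //= eqxx big1 // => j; rewrite -val_eqE /= => jm.
  by rewrite eqSS eq_sym (negbTE jm).
have {}E : \sum_(i < k) \sum_(j < k) (nth 0 t i == j.+1 : nat)
     + \sum_(i < k) (troot t i : nat) = k.
  rewrite -big_split /= (eq_bigr (fun=> 1)) => [|i _]; last exact: E.
  by rewrite sum_nat_const card_ord muln1.
have -> : \sum_(i < k) \sum_(j < k) (tadj t i j : nat) =
    \sum_(i < k) \sum_(j < k) (nth 0 t i == j.+1 : nat) +
    \sum_(i < k) \sum_(j < k) (nth 0 t i == j.+1 : nat).
  rewrite [X in _ + X]exchange_big -big_split /=; apply: eq_bigr => i _.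
  rewrite -big_split /=; apply: eq_bigr => j _; rewrite /tadj.
  (* The two disjuncts of [tadj] exclude each other, because a parent precedes its child. *)
  have := wf_treeP wft i; have := wf_treeP wft j.
  by case: eqP => [->|_]; case: eqP => [->|_] //; lia.
lia.
Qed.

Lemma plant_edges : \sum_x \sum_y (plant x y : nat) =
  \sum_x \sum_y (H x y : nat) + 2 * k.
Proof.
rewrite big_split_ord /= -tree_edges.
have -> : \sum_(i < n) \sum_y (plant (lshift k i) y : nat) =
   \sum_x \sum_y (H x y : nat) + \sum_(i < k) (troot t i : nat).
  under [LHS]eq_bigr => i _ do rewrite big_split_ord /=.
  rewrite big_split /=; congr (_ + _).
    by apply: eq_bigr => i _; apply: eq_bigr => j _; rewrite plantE.
  rewrite exchange_big; apply: eq_bigr => i _ /=.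
  rewrite (bigD1 v) //= plantE eqxx /= big1 ?addn0 // => j jv.
  by rewrite plantE (negbTE jv).
have -> : \sum_(i < k) \sum_y (plant (rshift n i) y : nat) =
    \sum_(i < k) (troot t i : nat) + \sum_(i < k) \sum_(j < k) (tadj t i j : nat).
  under eq_bigr => i _ do rewrite big_split_ord /=.
  rewrite big_split /=; congr (_ + _); apply: eq_bigr => i _.
    rewrite (bigD1 v) //= plantE eqxx /= big1 ?addn0 // => j jv.
    by rewrite plantE (negbTE jv).
  by apply: eq_bigr => j _; rewrite plantE.
by rewrite -addnA mul2n -addnn; congr (_ + _); rewrite addnA addnC.
Qed.

(** A retraction that folds the tree onto [v]: edges go to edges or to the single vertex [v], so
    connections survive. *)
Definition unplant (x : 'I_(n + k)) : 'I_n :=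
  if split x is inl a then a else v.

Lemma unplantl a : unplant (lshift k a) = a.
Proof. by rewrite /unplant split_lshift. Qed.
Lemma unplantr i : unplant (rshift n i) = v.
Proof. by rewrite /unplant split_rshift. Qed.

Lemma connect_unplant x y : connect plant x y -> connect H (unplant x) (unplant y).
Proof.
case/connectP => p; elim: p x => [|z p IH] x /=; first by move=> _ ->.
case/andP => exz pz E; apply: connect_trans (IH z pz E) => {p IH pz E}.
move: exz; elim/ord_split: x => a; elim/ord_split: z => b; rewrite !plantE.
- by rewrite !unplantl; apply: connect1.
- by rewrite unplantl unplantr => /andP[/eqP -> _].
- by rewrite unplantl unplantr => /andP[/eqP -> _].
- by rewrite !unplantr.
Qed.

Lemma connect_plant a b : connect H a b -> connect plant (lshift k a) (lshift k b).
Proof.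
case/connectP => p; elim: p a => [|z p IH] a /=; first by move=> _ ->.
case/andP => exz pz E; apply: connect_trans (IH z pz E).
by apply: connect1; rewrite plantE.
Qed.

Lemma limb_plant : limb plant [ffun i => rshift n i] (lshift k v).
Proof.
apply/and3P; split.
- by apply/injectiveP => i j; rewrite !ffunE => /rshift_inj.
- by apply/forallP => i; rewrite ffunE eq_rlshift.
apply/forallP => i; apply/forallP; elim/ord_split => a; rewrite ffunE plantE.
  rewrite eq_lshift; case: existsP => [[j]|_]; last by rewrite orbF.
  by rewrite ffunE eq_lrshift.
rewrite eq_rlshift /=; apply/eqP; apply/idP/existsP => [ai|[j]].
  by exists a; rewrite ffunE eqxx.
by rewrite ffunE eq_rshift => /andP[/eqP ->].
Qed.

Lemma deg_plant_lshift a :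
  #|[set b | H a b]| <= #|[set y | plant (lshift k a) y]|.
Proof.
rewrite -(card_imset _ (@lshift_inj n k)); apply/subset_leq_card/subsetP => y.
by case/imsetP => b; rewrite inE => Hab ->; rewrite inE plantE.
Qed.

(** Planting does not decrease degrees, so an old small neighbour was small before; the others are
    among the [k] new vertices. *)
Lemma small_nbrs_plant d :
  #|small_nbrs plant d (lshift k v)| <= #|small_nbrs H d v| + k.
Proof.
rewrite -(card_imset _ (@lshift_inj n k)) -[X in _ <= _ + X]card_ord -cardsT.
rewrite -(card_imset _ (@rshift_inj n k)).
apply: leq_trans (leq_card_setU _ _); apply/subset_leq_card/subsetP.
elim/ord_split => a; rewrite !inE; last by move=> _; rewrite (imset_f (@rshift n k)) ?orbT.
rewrite plantE => /andP[Hva da]; rewrite mem_imset ?inE; last exact: lshift_inj.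
by rewrite Hva (leq_trans (deg_plant_lshift a) da).
Qed.

(** A limb that avoids the new vertices lies in the old graph together with its root, and the
    folding map puts it in the component of [v], which has no limb. *)
Lemma lonely_plant D : limb_free t H v ->
  #|small_nbrs H k.+1 v| + k <= D ->
  lonely D plant [ffun i => rshift n i] (lshift k v).
Proof.
move=> free sD; apply/and3P; split; first exact: limb_plant.
  exact: leq_trans (small_nbrs_plant _) sD.
apply/forallP => f; apply/forallP => u; apply/implyP => /andP[L c].
apply: contraT => /existsPn M.
have fl i : {a | f i = lshift k a}.
  case: (split_ordP (f i)) => [a ->|j E]; first by exists a.
  exfalso; have := M j; rewrite ffunE negb_or => /andP[_ /existsP[]].
  by exists i; rewrite E.
have [a ua] : {a | u = lshift k a}.
  case: (split_ordP u) => [a ->|j E]; first by exists a.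
  by exfalso; have := M j; rewrite ffunE E eqxx.
pose f' := [ffun i => sval (fl i)].
have fE i : f i = lshift k (f' i) by rewrite ffunE; case: (fl i).
have := forallP free f' => /forallP/(_ a)/negP[]; apply/andP; split; last first.
  by have := connect_unplant c; rewrite ua !unplantl.
apply/and3P; split.
- by apply/injectiveP => i j E; apply: (limb_inj L); rewrite !fE E.
- apply/forallP => i; apply: contraNneq (limb_root i L) => E.
  by rewrite fE E ua.
apply/forallP => i; apply/forallP => y.
rewrite -plant_ll -fE (limb_adj _ _ L) ua eq_lshift; apply/eqP; congr (_ || _).
by apply: eq_existsb => j; rewrite fE eq_lshift.
Qed.

End Plant.
Arguments plant t {n} H v x y.

(** * Vertices with few neighbours of small degree *)

Section Good.
Variables (T : finType) (e : rel T).
Hypothesis esym : symmetric e.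

Lemma connect_nbr x v s : connect e x v -> e v s -> connect e x s.
Proof. by move=> c /connect1; apply: connect_trans. Qed.

(** Count the pairs of a vertex [v] of the component and a small neighbour [s]. Each [s] occurs at
    most [d] times, so the average over [v] is at most [d], and at most half of the vertices exceed
    [2 * d]. *)
Lemma card_good_vertices d x : 0 < d ->
  #|[set v | connect e x v]| <=
  2 * #|[set v | connect e x v & #|small_nbrs e d v| <= 2 * d]|.
Proof.
move=> d0; set C := [set v | _]; set G := [set v | _ & _].
have E : \sum_(v in C) #|small_nbrs e d v| <= #|C| * d.
  apply: (@leq_trans (\sum_(v in C) \sum_(s in C | #|[set y | e s y]| <= d) (e v s : nat))).
    apply: leq_sum => v vC; rewrite -sum1_card big_mkcond [leqRHS]big_mkcond /=.
    apply: leq_sum => s _; rewrite inE andbC; case: (_ <= d); rewrite ?andbF //= andbT.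
    case evs: (e v s); last by case: ifP.
    by move: vC; rewrite !inE => /connect_nbr/(_ evs) ->.
  rewrite exchange_big /= -sum_nat_const big_mkcondr /=; apply: leq_sum => s sC.
  case: ifP => // ds; apply: leq_trans ds; rewrite -sum1_card big_mkcond /= [leqRHS]big_mkcond /=.
  by apply: leq_sum => v _; rewrite !inE esym; case: (connect _ _ _); case: (e s v).
have GC : G \subset C by apply/subsetP => v; rewrite !inE => /andP[].
have B : #|C :\: G| * (2 * d).+1 <= #|C| * d.
  apply: leq_trans E; rewrite -sum_nat_const big_mkcond [leqRHS]big_mkcond /=.
  apply: leq_sum => v _; rewrite !inE; case: (connect e x v) => //=.
  by rewrite andbT; case: (leqP _ (2 * d)).
have := cardsD C G; rewrite (setIidPr GC) => EB; have := subset_leq_card GC; nia.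
Qed.
End Good.

(** A form that evaluates on concrete lists. *)
Lemma wf_treeE (t : seq nat) : wf_tree t = all (fun i => nth 0 t i <= i) (iota 0 (size t)).
Proof.
apply/forallP/allP => [H i|H i]; last by apply: H; rewrite mem_iota /=.
by rewrite mem_iota /= => it; apply: (H (Ordinal it)).
Qed.

(** * Replacing a pendant tree *)

Section Hanging.
Variables (k : nat) (T : finType) (f : {ffun 'I_k -> T}) (u : T).
Hypotheses (finj : injective f) (fu : forall i, f i != u).

(** The adjacency clause of [limb], with the number [k] of vertices separate from the list, so that
    two trees can be hung on the same [f]. *)
Definition attached (t : seq nat) (e : rel T) : Prop := forall i y,
  e (f i) y = (y == u) && troot t i || [exists j, (y == f j) && tadj t i j].

Local Notation S := (f @: [set: 'I_k]).

Lemma mem_hung i : f i \in S. Proof. exact: imset_f. Qed.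

Lemma root_nhung : u \notin S.
Proof. by apply/imsetP => -[i _ E]; have := fu i; rewrite -E eqxx. Qed.

Lemma hungP x : reflect (exists i, x = f i) (x \in S).
Proof. by apply: (iffP imsetP) => [[i _ ->]|[i ->]]; exists i. Qed.

Lemma attached_in t e i j : attached t e -> e (f i) (f j) = tadj t i j.
Proof.
move=> /(_ i (f j)) ->; rewrite (negbTE (fu j)) /=; apply/existsP/idP => [[l]|ij].
  by case/andP => /eqP/finj ->.
by exists j; rewrite eqxx.
Qed.

Lemma attached_out t e i y : attached t e -> y \notin S -> e (f i) y = (y == u) && troot t i.
Proof.
move=> /(_ i y) -> yS; case: existsP => [[j /andP[/eqP E _]]|_]; last by rewrite orbF.
by rewrite E mem_hung in yS.
Qed.

Definition tdeg (t : seq nat) (i : 'I_k) : nat := \sum_(j < k) tadj t i j + troot t i.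

Lemma attached_deg t e i : attached t e -> #|[set y | e (f i) y]| = tdeg t i.
Proof.
move=> at_e; have -> : [set y | e (f i) y] = f @: [set j : 'I_k | tadj t i j] :|: [set y | (y == u) && troot t i].
  apply/setP => y; rewrite !inE (at_e i y) orbC; congr (_ || _).
  apply/existsP/imsetP => [[j /andP[/eqP -> ij]]|[j]]; first by exists j; rewrite ?inE.
  by rewrite inE => ij ->; exists j; rewrite eqxx.
rewrite cardsU (_ : _ :&: _ = set0) ?cards0 ?subn0; last first.
  apply/setP => y; rewrite !inE; apply/andP => -[/imsetP[j _ ->]].
  by rewrite (negbTE (fu j)).
rewrite card_imset // /tdeg; congr (_ + _).
  by rewrite -sum1_card big_mkcond; apply: eq_bigr => j _; rewrite inE; case: tadj.
case: (troot t i); last by apply: eq_card0 => y; rewrite !inE andbF.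
by rewrite -[RHS](cards1 u); apply: eq_card => y; rewrite !inE andbT.
Qed.

(** The neighbour outside the tree makes the inequality strict; with two children of the root this
    gives the degree at least 3 that keeps tail walks away from [u]. *)
Lemma root_deg t e y : symmetric e -> attached t e -> y \notin S -> e u y ->
  \sum_(i < k) troot t i < #|[set z | e u z]|.
Proof.
move=> es at_e yS uy; have -> : \sum_(i < k) troot t i = #|f @: [set i : 'I_k | troot t i]|.
  rewrite card_imset // -sum1_card [RHS]big_mkcond; apply: eq_bigr => j _.
  by rewrite inE; case: troot.
apply/proper_card/properP; split.
  apply/subsetP => z /imsetP[i]; rewrite inE => ri ->.
  by rewrite inE es (at_e i u) eqxx ri.
exists y; first by rewrite inE.
by apply: contra yS => /imsetP[i _ ->]; apply: mem_hung.
Qed.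

(** Only pairs that meet the image of [f] are redefined, so the vertex set and the rest of the graph
    are kept when one tree replaces another. *)
Definition hang (t : seq nat) (e : rel T) : rel T := fun x y =>
  match [pick i | f i == x], [pick j | f j == y] with
  | Some i, Some j => tadj t i j
  | Some i, None => (y == u) && troot t i
  | None, Some j => (x == u) && troot t j
  | None, None => e x y
  end.

Lemma pick_hung i : [pick j | f j == f i] = Some i.
Proof.
case: pickP => [j /eqP/finj -> //|/(_ i)]; by rewrite eqxx.
Qed.

Lemma pick_nhung x : x \notin S -> [pick j | f j == x] = None.
Proof. by move=> xS; case: pickP => // i /eqP E; rewrite -E mem_hung in xS. Qed.

Lemma hang_in t e i j : hang t e (f i) (f j) = tadj t i j.
Proof. by rewrite /hang !pick_hung. Qed.

Lemma hang_inout t e i y : y \notin S -> hang t e (f i) y = (y == u) && troot t i.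
Proof. by move=> yS; rewrite /hang pick_hung pick_nhung. Qed.

Lemma hang_outin t e i y : y \notin S -> hang t e y (f i) = (y == u) && troot t i.
Proof. by move=> yS; rewrite /hang pick_hung pick_nhung. Qed.

Lemma hang_out t e x y : x \notin S -> y \notin S -> hang t e x y = e x y.
Proof. by move=> xS yS; rewrite /hang !pick_nhung. Qed.

Lemma attached_hang t e : attached t (hang t e).
Proof.
move=> i y; case: (boolP (y \in S)) => [/hungP[j ->]|yS].
  rewrite hang_in (negbTE (fu j)) /=; apply/idP/existsP => [ij|[l]].
    by exists j; rewrite eqxx.
  by case/andP => /eqP/finj ->.
rewrite hang_inout //; case: existsP => [[j /andP[/eqP E _]]|_]; last by rewrite orbF.
by rewrite E mem_hung in yS.
Qed.

Lemma hang_sym t e : symmetric e -> symmetric (hang t e).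
Proof.
move=> es x y; case: (boolP (x \in S)) => [/hungP[i ->]|xS];
  case: (boolP (y \in S)) => [/hungP[j ->]|yS].
- by rewrite !hang_in /tadj orbC.
- by rewrite hang_inout // hang_outin.
- by rewrite hang_inout // hang_outin.
- by rewrite !hang_out.
Qed.

Lemma hang_irr t e : k = size t -> wf_tree t -> irreflexive e -> irreflexive (hang t e).
Proof.
move=> kt wft ei x; case: (boolP (x \in S)) => [/hungP[i ->]|xS]; last by rewrite hang_out.
rewrite hang_in /tadj orbb; have := wf_treeP wft (cast_ord kt i) => /=; lia.
Qed.

Local Notation quad T := (T * T * T * T)%type.

(* The root of a limb is never on such a walk, its degree being at least 3. *)
Definition tail_walk (T0 : finType) (e : rel T0) (q : quad T0) : bool :=
  let: (x, y, z, s) := q in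
  [&& e x y, e y z, e z s, #|[set v | e x v]| == 1, #|[set v | e y v]| == 2,
      #|[set v | e z v]| == 2 & #|[set v | e s v]| == 2].

Definition tree_tail_walk (t : seq nat) (q : quad 'I_k) : bool :=
  let: (x, y, z, s) := q in
  [&& tadj t x y, tadj t y z, tadj t z s, tdeg t x == 1, tdeg t y == 2,
      tdeg t z == 2 & tdeg t s == 2].

Definition outside (q : quad T) : bool :=
  let: (x, y, z, s) := q in [&& x \notin S, y \notin S, z \notin S & s \notin S].

(** An edge between the tree and its outside ends in [u], whose degree exceeds 2. *)
Lemma small_deg_inside t e x y : symmetric e -> attached t e ->
  2 < #|[set v | e u v]| -> e x y ->
  #|[set v | e x v]| <= 2 -> #|[set v | e y v]| <= 2 -> (x \in S) = (y \in S).
Proof.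
move=> es at_e ud exy dx dy.
have xu : x != u by apply: contraTneq dx => ->; rewrite -ltnNge.
have yu : y != u by apply: contraTneq dy => ->; rewrite -ltnNge.
apply/idP/idP => [/hungP[i E]|/hungP[i E]]; apply: contraT => nS.
  by move: exy; rewrite E (attached_out _ at_e nS) (negbTE yu).
by move: exy; rewrite es E (attached_out _ at_e nS) (negbTE xu).
Qed.

(** By the degree conditions a tail walk is entirely inside or entirely outside the tree; inside,
    adjacency and degrees can be read off the list [t]. *)
Lemma tail_walks_attached t e : symmetric e -> attached t e ->
  2 < #|[set v | e u v]| ->
  #|[set q | tail_walk e q]| =
  #|[set q | tail_walk e q & outside q]| + #|[set q | tree_tail_walk t q]|.
Proof.
move=> es at_e ud.
pose F (q : quad 'I_k) : quad T := let: (x, y, z, s) := q in (f x, f y, f z, f s).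
have Finj : injective F by case=> [[[a b] c] d] [[[a' b'] c'] d'] [] /finj -> /finj -> /finj -> /finj ->.
rewrite -(card_imset _ Finj) -(cardsID [set q | outside q]); congr (_ + _).
  by apply: eq_card => q; rewrite !inE.
apply: eq_card => -[[[x y] z] s]; rewrite !inE /=; apply/andP/imsetP; last first.
  case=> -[[[a b] c] d]; rewrite inE /= => W [-> -> -> ->].
  by rewrite !(attached_in _ _ at_e) !(attached_deg _ at_e) !mem_hung.
case=> nout /and5P[xy yz zs /eqP dx /and3P[/eqP dy /eqP dz /eqP ds]].
have Exy : (x \in S) = (y \in S) by apply: small_deg_inside at_e ud xy _ _; rewrite ?dx ?dy.
have Eyz : (y \in S) = (z \in S) by apply: small_deg_inside at_e ud yz _ _; rewrite ?dy ?dz.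
have Ezs : (z \in S) = (s \in S) by apply: small_deg_inside at_e ud zs _ _; rewrite ?dz ?ds.
move: nout; rewrite Exy Eyz Ezs; case: (boolP (s \in S)) => // sS _.
move: Exy Eyz Ezs; rewrite sS => Ex Ey Ez; rewrite Ez in Ey; rewrite Ey in Ex.
have [[a xa] [b yb]] := (hungP _ Ex, hungP _ Ey).
have [[c zc] [d sd]] := (hungP _ Ez, hungP _ sS); subst x y z s.
exists (a, b, c, d) => //; rewrite inE /= -!(attached_in _ _ at_e) -!(attached_deg _ at_e).
by rewrite xy yz zs dx dy dz ds.
Qed.

Lemma deg_outside t t' e e' x : symmetric e -> symmetric e' ->
  attached t e -> attached t' e' -> {in predC (mem S) &, e =2 e'} ->
  x \notin S -> x != u -> #|[set v | e x v]| = #|[set v | e' x v]|.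
Proof.
move=> es es' at_e at_e' ee' xS xu; apply: eq_card => v; rewrite !inE.
case: (boolP (v \in S)) => [/hungP[i ->]|vS]; last by rewrite ee' ?inE.
by rewrite es es' (attached_out _ at_e xS) (attached_out _ at_e' xS) (negbTE xu).
Qed.

(** Outside vertices other than [u] have the same degree in both graphs, and [u] fails the degree
    tests in both. *)
Lemma tail_walks_outside t t' e e' : symmetric e -> symmetric e' ->
  attached t e -> attached t' e' -> {in predC (mem S) &, e =2 e'} ->
  2 < #|[set v | e u v]| -> 2 < #|[set v | e' u v]| ->
  [set q | tail_walk e q & outside q] = [set q | tail_walk e' q & outside q].
Proof.
move=> es es' at_e at_e' ee' du du'; apply/setP => -[[[x y] z] s]; rewrite !inE /=.
have Edeg v d : v \notin S -> d <= 2 -> (#|[set w | e v w]| == d) = (#|[set w | e' v w]| == d).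
  move=> vS d2; have [->|vu] := eqVneq v u; last by rewrite (deg_outside es es' at_e at_e').
  by rewrite !gtn_eqF // (leq_ltn_trans d2).
apply/andP/andP => -[W O]; split=> //; move: O W => /and4P[xS yS zS sS].
  by rewrite !ee' ?inE // !Edeg.
by rewrite !ee' ?inE // !Edeg.
Qed.

End Hanging.

Lemma tail_walks_iso (T T' : finType) (e : rel T) (e' : rel T') :
  graph_iso e e' -> #|[set q | tail_walk e q]| = #|[set q | tail_walk e' q]|.
Proof.
case=> g [[h gK hK] gE].
pose F (q : T * T * T * T) := let: (x, y, z, s) := q in (g x, g y, g z, g s).
have ginj := can_inj gK.
have Finj : injective F by case=> [[[a b] c] d] [[[a' b'] c'] d'] [] /ginj -> /ginj -> /ginj -> /ginj ->.
have dg x : #|[set v | e' (g x) v]| = #|[set v | e x v]|.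
  by rewrite (nbrs_iso gK hK gE) card_imset.
rewrite -(card_imset _ Finj); apply: eq_card => -[[[x y] z] s].
rewrite -(hK x) -(hK y) -(hK z) -(hK s) inE /= !gE !dg; apply/imsetP/idP => [[[[[a b] c] d]]|W].
  by rewrite inE /= => W [/ginj -> /ginj -> /ginj -> /ginj ->].
by exists (h x, h y, h z, h s); rewrite ?inE.
Qed.

(** A fold over [iota] reduces by computation, unlike a big operator; conditions on concrete trees
    are evaluated in this form. *)
Definition nsum (k : nat) (F : nat -> nat) : nat := foldr (fun i s => F i + s) 0 (iota 0 k).

Lemma nsumE k (F : nat -> nat) : \sum_(i < k) F i = nsum k F.
Proof.
rewrite -(big_mkord xpredT F) /index_iota subn0 /nsum.
by elim: (iota 0 k) => [|a s IH]; rewrite ?big_nil // big_cons IH.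
Qed.

Definition ntdeg (k : nat) (t : seq nat) (i : nat) : nat :=
  nsum k (fun j => tadj t i j) + troot t i.

Definition ntail_walks (k : nat) (t : seq nat) : nat :=
  nsum k (fun x => nsum k (fun y => nsum k (fun z => nsum k (fun s =>
    [&& tadj t x y, tadj t y z, tadj t z s, ntdeg k t x == 1, ntdeg k t y == 2,
      ntdeg k t z == 2 & ntdeg k t s == 2])))).

Lemma card_tree_tail_walks (k : nat) (t : seq nat) :
  #|[set q : 'I_k * 'I_k * 'I_k * 'I_k | tree_tail_walk t q]| = ntail_walks k t.
Proof.
have dE (i : 'I_k) : tdeg t i = ntdeg k t i by rewrite /tdeg (nsumE k (fun j => tadj t i j)).
rewrite -sum1_card big_mkcond.
rewrite (eq_bigr (fun q => (tree_tail_walk t q : nat))) => [|q _]; last by rewrite inE; case: tree_tail_walk.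
transitivity (\sum_(x < k) \sum_(y < k) \sum_(z < k) \sum_(s < k) (tree_tail_walk t (x, y, z, s) : nat)).
  by rewrite !pair_bigA /=; apply: eq_bigr => -[[[x y] z] s].
rewrite /ntail_walks -nsumE; apply: eq_bigr => x _; rewrite -nsumE; apply: eq_bigr => y _.
rewrite -nsumE; apply: eq_bigr => z _; rewrite -nsumE; apply: eq_bigr => s _.
by rewrite /= !dE.
Qed.

Section Replacement.
Variables (k : nat) (T : finType) (f : {ffun 'I_k -> T}) (u : T) (e : rel T).
Hypotheses (finj : injective f) (fu : forall i, f i != u).
Hypotheses (es : symmetric e) (ei : irreflexive e).
Variables (tA tB : seq nat).
Hypothesis at_e : attached f u tA e.
Local Notation S := (f @: [set: 'I_k]).

(** The numbers of tail walks differ: outside the tree the walks are the same, inside they are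
    counted by [ntail_walks]. *)
Lemma hang_not_iso y : y \notin S -> e u y -> u != y ->
  2 <= nsum k (fun i => troot tA i) -> 2 <= nsum k (fun i => troot tB i) ->
  ntail_walks k tA != ntail_walks k tB -> ~ graph_iso e (hang f u tB e).
Proof.
move=> yS uy uny rA rB wAB /tail_walks_iso.
have uS := root_nhung fu.
have es' : symmetric (hang f u tB e) by apply: hang_sym.
have at_e' : attached f u tB (hang f u tB e) by apply: attached_hang.
have dA : 2 < #|[set v | e u v]|.
  by apply: leq_ltn_trans (root_deg finj es at_e yS uy); rewrite (nsumE k (fun i => troot tA i)).
have dB : 2 < #|[set v | hang f u tB e u v]|.
  apply: leq_ltn_trans (root_deg finj es' at_e' yS _); last by rewrite hang_out.
  by rewrite (nsumE k (fun i => troot tB i)).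
have ee' : {in predC (mem S) &, e =2 hang f u tB e}.
  by move=> a b aS bS; rewrite hang_out.
rewrite (tail_walks_attached finj fu es at_e dA) (tail_walks_attached finj fu es' at_e' dB).
rewrite (tail_walks_outside es es' at_e at_e' ee' dA dB) !card_tree_tail_walks.
by move/addnI/eqP; rewrite (negbTE wAB).
Qed.

(** Without such a neighbour the tree and its root would be closed under adjacency and would contain
    the whole component. *)
Lemma exit_root x : connect e u x -> x \notin u |: S -> exists2 y, y \notin S & e u y.
Proof.
move=> c xS; apply: contrapT => no.
have cl a b : a \in u |: S -> e a b -> b \in u |: S.
  rewrite !in_setU1 => /orP[/eqP -> ub|/hungP[i ->]].
    by apply/orP; right; apply: contrapT => /negP bS; apply: no; exists b.
  by rewrite (at_e i b) => /orP[/andP[-> //]|/existsP[j /andP[/eqP -> _]]]; rewrite mem_hung orbT.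
have key p a : a \in u |: S -> path e a p -> last a p \in u |: S.
  by elim: p a => //= b p IH a aS /andP[ab]; apply: IH; apply: cl ab.
by case/negP: xS; case/connectP: c => p up ->; apply: key; rewrite // setU11.
Qed.

End Replacement.

Section InducedLimb.
Variables (n : nat) (e : rel 'I_n) (C : {set 'I_n}) (t : seq nat).
Hypotheses (es : symmetric e) (ei : irreflexive e) (wft : wf_tree t).
Variables (f : {ffun 'I_(size t) -> 'I_n}) (u : 'I_n).
Hypotheses (L : limb e f u) (Ccomp : is_component e C) (uC : u \in C).
Hypothesis Cbig : (size t).+1 < #|C|.
Local Notation k := (size t).
Local Notation V := {x : 'I_n | x \in C}.

Lemma component_connect x y : x \in C -> (y \in C) = connect e x y.
Proof.
case: Ccomp => z ->; rewrite !inE => zx.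
exact: (same_connect (sym_connect_sym es) zx).
Qed.

(** The size of [C] leaves a vertex besides the k + 1 vertices of the rooted tree, hence a neighbour
    of the root outside the tree. *)
Lemma induced_limb : exists f' : {ffun 'I_k -> V}, exists u' : V,
  [/\ injective f', forall i, f' i != u', attached f' u' t (@Defs.induced _ e C) &
   exists y, [/\ y \notin f' @: [set: 'I_k], Defs.induced e u' y & u' != y]].
Proof.
have fC i : f i \in C by rewrite (component_connect _ uC) limb_connect.
pose f' : {ffun 'I_k -> V} := [ffun i => exist _ (f i) (fC i)].
pose u' : V := exist _ u uC.
have vf i : val (f' i) = f i by rewrite ffunE.
have f'inj : injective f' by move=> i j /(congr1 val); rewrite !vf; apply: limb_inj L _ _.
have f'u i : f' i != u' by rewrite -val_eqE vf (limb_root i L).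
have at_e : attached f' u' t (@Defs.induced _ e C).
  move=> i y; rewrite /Defs.induced vf (limb_adj _ _ L) -val_eqE; congr (_ || _).
  by apply: eq_existsb => j; rewrite -[in RHS]val_eqE vf.
exists f', u'; split=> //.
have at_L : attached f u t e by move=> i y; apply: limb_adj.
have [x xC xS] : exists2 x, x \in C & x \notin u |: f @: [set: 'I_k].
  apply/subsetPn; apply: contraL Cbig => /subset_leq_card CS; rewrite -leqNgt.
  apply: leq_trans CS _; rewrite cardsU1 -add1n leq_add //; first by case: (_ \notin _).
  by rewrite -[leqRHS]card_ord -cardsT; apply: leq_imset_card.
have [y yS uy] : exists2 y, y \notin f @: [set: 'I_k] & e u y.
  by apply: (exit_root at_L _ xS); rewrite -(component_connect x uC).
have yC : y \in C by rewrite (component_connect _ uC) connect1.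
exists (exist _ y yC); split=> //; last first.
  by rewrite -val_eqE /=; apply: contraTneq uy => <-; rewrite ei.
apply: contra yS => /imsetP[i _ /(congr1 val)]; rewrite vf /= => ->.
exact: imset_f.
Qed.

End InducedLimb.

(** * Counting *)

(** Composing with the inverse of one such permutation gives permutations that fix the last [k]
    points. *)
Lemma card_perm_prescribed (n k : nat) (f : 'I_k -> 'I_(n + k)) :
  (#|[set s : {perm 'I_(n + k)} | [forall i, s (rshift n i) == f i]]| <= n`!)%N.
Proof.
set A := [set s | _].
have [->|[s0 s0A]] := set_0Vmem A; first by rewrite cards0.
have As s : s \in A -> forall i, s (rshift n i) = f i.
  by rewrite inE => /forallP H i; apply/eqP.
rewrite -(card_imset _ (mulIg (s0^-1)%g)).
have <- : #|perm_on [set lshift k a | a : 'I_n]| = n`!.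
  by rewrite card_perm card_imset ?card_ord //; apply: lshift_inj.
apply/subset_leq_card/subsetP => _ /imsetP[s sA ->].
apply/subsetP; elim/ord_split => [a|i]; first by rewrite imset_f.
rewrite !inE permM (As _ sA) -(As _ s0A) permK eqxx //.
Qed.

(** * Exploring the components of the first vertices *)

Section Exploration.
Variables (n : nat) (e : rel 'I_n).
Hypothesis esym : symmetric e.

Definition low (j : nat) : {set 'I_n} := [set x : 'I_n | x < j].

Definition explored (j : nat) : {set 'I_n} :=
  [set x | [exists y in low j, connect e x y]].

(** The vertices at distance at most [i] from [low j]. *)
Definition ball (j i : nat) : {set 'I_n} :=
  iter i (fun B : {set 'I_n} => [set x | (x \in B) || [exists y in B, e x y]]) (low j).

Lemma ball_explored j x : x \in explored j -> exists i, x \in ball j i.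
Proof.
rewrite inE => /existsP[y /andP[yj /connectP[p]]].
elim: p x => [|z p IH] x /=; first by move=> _ Ey; exists 0; rewrite -Ey.
case/andP => exz pz Ey; have [i zi] := IH z pz Ey.
by exists i.+1; rewrite /= inE; apply/orP; right; apply/existsP; exists z; rewrite zi.
Qed.

Lemma low_explored j : low j \subset explored j.
Proof. by apply/subsetP => x xj; rewrite inE; apply/existsP; exists x; rewrite xj connect0. Qed.

Lemma explored_closed j x y : x \in explored j -> e x y -> y \in explored j.
Proof.
rewrite !inE => /existsP[z /andP[zj cxz]] exy; apply/existsP; exists z.
by rewrite zj /=; apply: connect_trans cxz; apply: connect1; rewrite esym.
Qed.

(* The distance d to [low j] decreases along f, hence f has no 2-cycle and the edges
   {x, f x} are distinct. *)
Lemma bfs_parent j : exists f : 'I_n -> 'I_n, exists d : 'I_n -> nat,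
  forall x, x \in explored j :\: low j -> [/\ e x (f x), f x \in explored j & d (f x) < d x].
Proof.
have [d dP] : exists d : 'I_n -> nat, forall x, x \in explored j ->
    x \in ball j (d x) /\ forall i, x \in ball j i -> d x <= i.
  apply: (@fin_all_exists _ _ (fun x dx => x \in explored j -> x \in ball j dx /\ forall i, x \in ball j i -> dx <= i)).
  move=> x; have [xj|_] := boolP (x \in explored j); last by exists 0.
  have [m mP m_min] := ex_minnP (ball_explored xj).
  by exists m.
have [f fP] : exists f : 'I_n -> 'I_n, forall x, x \in explored j :\: low j ->
    [/\ e x (f x), f x \in explored j & d (f x) < d x].
  apply: (@fin_all_exists _ _ (fun x y => x \in explored j :\: low j ->
    [/\ e x y, y \in explored j & d y < d x])) => x.
  have [|_] := boolP (x \in explored j :\: low j); last by exists x.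
  rewrite in_setD => /andP[xl xj]; have [xb xm] := dP x xj.
  (* The distance is positive outside [low j]; any neighbour in the previous ball serves as
     parent. *)
  case E: (d x) xb => [|i]; first by rewrite /= (negbTE xl).
  rewrite /= inE => /orP[xi|/existsP[y /andP[yi exy]]].
    by have := xm i xi; rewrite E ltnn.
  have yj := explored_closed xj exy.
  by exists y => _; split => //; have [_ /(_ i yi)] := dP y yj.
by exists f, d.
Qed.

Lemma explored_step j s : (forall x, #|[set y | connect e x y]| <= s) ->
  #|explored j.+1| <= #|explored j| + s.
Proof.
move=> small; have [jn|nj] := ltnP j n; last first.
  apply: leq_trans (leq_addr _ _); apply/subset_leq_card/subsetP => x; rewrite !inE.
  case/existsP => y /andP[_ c]; apply/existsP; exists y; rewrite c inE.
  by rewrite (leq_trans (ltn_ord y) nj).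
apply: leq_trans (leq_add (leqnn _) (small (Ordinal jn))).
apply: leq_trans (leq_card_setU _ _); apply/subset_leq_card/subsetP => x; rewrite !inE.
case/existsP => y; rewrite inE ltnS leq_eqVlt => /andP[/orP[/eqP yj|yj] c].
  apply/orP; right; rewrite (sym_connect_sym esym).
  by have -> : Ordinal jn = y by apply: val_inj.
by apply/orP; left; apply/existsP; exists y; rewrite inE yj.
Qed.

(** Take the least [j] with at least [s] explored vertices: before it there were fewer than [s], and
    one component adds at most [s]. *)
Lemma explored_size s : s <= n -> (forall x, #|[set y | connect e x y]| <= s) ->
  exists2 j, j <= n & s <= #|explored j| <= 2 * s.
Proof.
move=> sn small.
have full : s <= #|explored n|.
  apply: leq_trans sn _; rewrite -[leqLHS]card_ord -cardsT; apply/subset_leq_card/subsetP => x _.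
  by apply: (subsetP (low_explored n)); rewrite inE.
have ex : exists j, s <= #|explored j| by exists n.
have [j sj jmin] := ex_minnP ex.
exists j; first exact: jmin.
rewrite sj /=; case: j sj jmin => [|j] sj jmin.
  suff -> : #|explored 0| = 0 by [].
  apply/eqP; rewrite cards_eq0; apply/eqP/setP => x; rewrite !inE.
  by apply/existsP => -[y]; rewrite inE.
have := explored_step j small; have : #|explored j| < s.
  by rewrite ltnNge; apply/negP => /jmin; rewrite ltnn.
by move=> /ltnW js /leq_trans; apply; rewrite mul2n -addnn leq_add2r.
Qed.

End Exploration.

(** The coordinate of a sample that decides the pair of [x] and [y], in either order; [None] on the
    diagonal. *)
Definition upair_opt n (x y : 'I_n) : option (upair n) :=
  if insub (x, y) is Some q then Some q else insub (y, x).

Lemma gnp_graph_opt n (w : {ffun upair n -> bool}) x y q :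
  upair_opt x y = Some q -> gnp_graph w x y = w q.
Proof. by rewrite /upair_opt /gnp_graph; case: insub => [q'|]; [case=> ->|move=> ->]. Qed.

Lemma upair_opt_val n (x y : 'I_n) q : upair_opt x y = Some q ->
  val q = (x, y) \/ val q = (y, x).
Proof.
rewrite /upair_opt; case: insubP => [q' _ E [<-]|_]; first by left.
by case: insubP => [q' _ E [<-]|//]; right.
Qed.

Lemma upair_opt_neq n (x y : 'I_n) : x != y -> exists q, upair_opt x y = Some q.
Proof.
rewrite -val_eqE neq_ltn /upair_opt => /orP[xy|yx].
  by rewrite insubT; eexists.
by case: insubP => [q' _ _|_]; [exists q'|rewrite insubT; eexists].
Qed.

Lemma upair_opt_inj n (x y x' y' : 'I_n) : x != y ->
  upair_opt x y = upair_opt x' y' -> x = x' /\ y = y' \/ x = y' /\ y = x'.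
Proof.
move=> /upair_opt_neq[q E] E'; rewrite E in E'.
have := upair_opt_val E; have := upair_opt_val (esym E').
by case=> -> [] [-> ->]; [left|right|right|left].
Qed.

Lemma leq_fact_exp n k : n`! * n ^ k <= (n + k)`!.
Proof.
elim: k => [|k IH]; first by rewrite muln1 addn0.
by rewrite addnS factS expnS mulnCA; apply: leq_mul => //; apply: leqW; apply: leq_addr.
Qed.

Local Open Scope ring_scope.

(** * The measure of the random graph *)

Section Gnp.
Variables (R : realType) (n : nat).
Implicit Types (p : R) (w : {ffun upair n -> bool}).

Lemma gnp_weight_ge0 p w : 0 <= p <= 1 -> 0 <= gnp_weight p w.
Proof.
case/andP => p0 p1; apply: prodr_ge0 => q _.
by case: (w q); rewrite ?subr_ge0.
Qed.

Lemma sum_gnp_weight p : \sum_(w : {ffun upair n -> bool}) gnp_weight p w = 1.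
Proof.
rewrite /gnp_weight -(bigA_distr_bigA (fun _ b => if b then p else 1 - p)) big1 // => q _.
by rewrite big_bool /= addrC subrK.
Qed.

(** The sum factors over the pairs: a prescribed pair contributes p or 1 - p, and a free one p + (1
    - p) = 1. *)
Lemma gnp_cylinder p (P1 P0 : {set upair n}) : [disjoint P1 & P0] ->
  \sum_(w : {ffun upair n -> bool} | [forall q, ((q \in P1) ==> w q) && ((q \in P0) ==> ~~ w q)]) gnp_weight p w
   = p ^+ #|P1| * (1 - p) ^+ #|P0|.
Proof.
move=> dis.
pose F q (b : bool) := if ((q \in P1) ==> b) && ((q \in P0) ==> ~~ b) then
   (if b then p else 1 - p) else 0.
transitivity (\sum_(w : {ffun upair n -> bool}) \prod_q F q (w q)).
  rewrite big_mkcond; apply: eq_bigr => w _; case: forallP => [A|/forallP].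
    by apply: eq_bigr => q _; rewrite /F A.
  rewrite negb_forall => /existsP[q Hq].
  by rewrite (bigD1 q) //= /F (negbTE Hq) mul0r.
rewrite -bigA_distr_bigA.
transitivity (\prod_q ((if q \in P1 then p else 1) * (if q \in P0 then 1 - p else 1))).
  apply: eq_bigr => q _; rewrite big_bool /F /=.
  case: (boolP (q \in P1)) => /= q1.
    by rewrite (disjointFr dis q1) /= mulr1 addr0.
  case: (q \in P0) => /=; first by rewrite add0r mul1r.
  by rewrite mul1r addrC subrK.
by rewrite big_split /= -!big_mkcond /= !prodr_const.
Qed.

Lemma gnp_graph_lt w (q : upair n) : gnp_graph w (val q).1 (val q).2 = w q.
Proof. by rewrite /gnp_graph -surjective_pairing valK. Qed.

Lemma gnp_graph_sym w : symmetric (gnp_graph w).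
Proof.
move=> x y; rewrite /gnp_graph.
case: insubP => [q /= xy Eq|/= xy]; case: insubP => [q' /= xy' Eq'|/= xy'] //.
by have := ltn_trans xy xy'; rewrite ltnn.
Qed.

Lemma gnp_graph_irr w : irreflexive (gnp_graph w).
Proof. by move=> x; rewrite /gnp_graph !insubF //= ltnn. Qed.

Definition graph_code (g : rel 'I_n) : {ffun upair n -> bool} :=
  [ffun q => g (val q).1 (val q).2].

Lemma graph_codeK (g : rel 'I_n) : symmetric g -> irreflexive g ->
  gnp_graph (graph_code g) =2 g.
Proof.
move=> gs gi x y; rewrite /gnp_graph.
case: insubP => [q /= xy Eq|/= xy]; first by rewrite ffunE (Eq : val q = _).
case: insubP => [q /= xy' Eq|/= xy']; first by rewrite ffunE (Eq : val q = _) gs.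
suff -> : x = y by rewrite gi.
by apply: val_inj; move: xy xy'; case: ltngtP.
Qed.

Lemma sum_upair (F : 'I_n * 'I_n -> nat) :
  (\sum_(q : upair n) F (val q) = \sum_(x : 'I_n * 'I_n | (x.1 < x.2)%N) F x)%N.
Proof.
rewrite [RHS](reindex_omap (val : upair n -> _) insub) /= => [|x xlt].
  by apply: eq_bigl => q; rewrite valK eqxx andbT (valP q).
by rewrite insubT.
Qed.

Lemma gnp_graph_edges w :
  (\sum_x \sum_y (gnp_graph w x y : nat) = 2 * #|[set q | w q]|)%N.
Proof.
have -> : (#|[set q | w q]| = \sum_(x : 'I_n * 'I_n | (x.1 < x.2)%N) (gnp_graph w x.1 x.2 : nat))%N.
  rewrite -(sum_upair (fun x => gnp_graph w x.1 x.2 : nat)) -sum1_card big_mkcond /=.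
  by apply: eq_bigr => q _; rewrite inE gnp_graph_lt; case: (w q).
rewrite pair_bigA /= (bigID (fun x : 'I_n * 'I_n => (x.1 < x.2)%N)) /= mul2n -addnn; congr (_ + _)%N.
rewrite (bigID (fun x : 'I_n * 'I_n => (x.2 < x.1)%N)) /= [X in (_ + X)%N]big1 ?addn0.
  rewrite (reindex_inj (h := fun x : 'I_n * 'I_n => (x.2, x.1))) /=; last by case=> a b [c d] [-> ->].
  apply: eq_big => [[a b] /=|[a b] /= _]; last by rewrite gnp_graph_sym.
  by case: ltngtP.
case=> a b /= /andP[ab ba]; suff -> : a = b by rewrite gnp_graph_irr.
by apply: val_inj; move: ab ba; case: ltngtP.
Qed.

(** The edge count of the complete graph. *)
Lemma card_upair : (2 * #|{: upair n}| = n * n.-1)%N.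
Proof.
have := gnp_graph_edges [ffun=> true].
rewrite [X in (_ = 2 * X)%N -> _](_ : _ = #|{: upair n}|); last first.
  by apply: eq_card => q; rewrite !inE ffunE.
move=> <-; rewrite -[n in (n * _)%N]card_ord -sum_nat_const; apply: eq_bigr => x _.
rewrite (eq_bigr (fun y => (y != x : nat))) => [|y _].
  rewrite (bigD1 x) //= eqxx add0n (eq_bigr (fun=> 1%N)) => [|y ->] //.
  by rewrite sum1_card cardC1 card_ord.
rewrite /gnp_graph; case: insubP => [q /= xy _|/= xy].
  by rewrite ffunE -val_eqE /= neq_ltn xy orbT.
case: insubP => [q /= xy' _|/= xy']; first by rewrite ffunE -val_eqE /= neq_ltn xy'.
by rewrite -val_eqE /= neq_ltn (negbTE xy) (negbTE xy').
Qed.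

Lemma gnp_weightE p w :
  gnp_weight p w = p ^+ #|[set q | w q]| * (1 - p) ^+ (#|{: upair n}| - #|[set q | w q]|).
Proof.
rewrite /gnp_weight (bigID (fun q => w q)) /=; congr (_ * _).
  rewrite (eq_bigr (fun=> p)) => [|q ->] //; rewrite prodr_const; congr (_ ^+ _).
  by apply: eq_card => q; rewrite inE.
rewrite (eq_bigr (fun=> 1 - p)) => [|q /negbTE ->] //; rewrite prodr_const; congr (_ ^+ _).
by rewrite -(cardsC [set q | w q]) addKn; apply: eq_card => q; rewrite !inE.
Qed.

Lemma pr_le (p : R) (A B : pred {ffun upair n -> bool}) : 0 <= p <= 1 ->
  (forall w, A w -> B w) ->
  \sum_(w | A w) gnp_weight p w <= \sum_(w | B w) gnp_weight p w.
Proof.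
move=> p01 AB; rewrite big_mkcond [leRHS]big_mkcond; apply: ler_sum => w _.
case: ifP => [/AB -> //|_]; case: ifP => // _; exact: gnp_weight_ge0.
Qed.

End Gnp.

Section Planting.
Variables (R : realType) (t : seq nat) (n : nat) (p : R).
Hypothesis wft : wf_tree t.
Hypothesis p01 : 0 <= p <= 1.
Hypothesis n0 : (0 < n)%N.
Local Notation k := (size t).
Local Notation N := (n + size t)%N.
Implicit Types (w : {ffun upair n -> bool}) (v : 'I_n) (s : {perm 'I_N}).

(** The relabelling [s] lets the new vertices carry any labels; without it they would always be the
    last ones. *)
Definition planted w v s : {ffun upair N -> bool} :=
  graph_code (fun x y => plant t (gnp_graph w) v (s^-1 x)%g (s^-1 y)%g).

Lemma plantedE w v s x y :
  gnp_graph (planted w v s) (s x) (s y) = plant t (gnp_graph w) v x y.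
Proof.
rewrite graph_codeK ?permK // => [a b|a]; first exact: plant_sym (gnp_graph_sym _) _ _.
exact: plant_irr (@gnp_graph_irr n w) _.
Qed.

(** Planting creates k n + k (k - 1) / 2 new pairs, of which exactly k are edges, so the weight
    changes by this factor whatever [w], [v] and [s]. *)
Definition limb_prob : R := p ^+ k * (1 - p) ^+ (k * n + (k * k.-1)./2 - k).

Lemma planted_weight w v s :
  gnp_weight p (planted w v s) = gnp_weight p w * limb_prob.
Proof.
rewrite !gnp_weightE.
have E : #|[set q | planted w v s q]| = (#|[set q | w q]| + k)%N.
  apply/eqP; rewrite -(eqn_pmul2l (isT : (0 < 2)%N)) mulnDr -!gnp_graph_edges; apply/eqP.
  rewrite -(plant_edges (gnp_graph w) v wft); rewrite (reindex_inj (@perm_inj _ s)) /=.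
  apply: eq_bigr => x _; rewrite (reindex_inj (@perm_inj _ s)) /=.
  by apply: eq_bigr => y _; rewrite plantedE.
rewrite E exprD mulrACA; congr (_ * _); rewrite -exprD; congr (_ ^+ _).
have Un := card_upair n; have UN := card_upair N.
have mn : (#|[set q | w q]| <= #|{: upair n}|)%N := max_card _.
have kk : ((k * k.-1)./2 * 2 = k * k.-1)%N.
  by rewrite muln2 even_halfK // oddM; case: (k) => //= m; rewrite andNb.
have EN : (N * N.-1 = n * n.-1 + 2 * (k * n) + k * k.-1)%N.
  by case: (n) n0 => // m _; rewrite addSn /=; case: (k) => [|j] /=; lia.
(* This makes the truncated subtraction in [limb_prob] exact. *)
have kn : (k <= k * n)%N by apply: leq_pmulr.
move: Un UN mn kk EN kn; set U := #|_|; set m := #|[set q | w q]|; set U' := #|_|.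
move: (N * N.-1)%N (k * k.-1)%N (n * n.-1)%N (k * n)%N => a b c d; lia.
Qed.

End Planting.
Arguments planted t {n} w v s.

(** * Planting a pendant tree *)

Section PlantingCount.
Variables (R : realType) (t : seq nat) (n : nat) (p : R).
Hypothesis wft : wf_tree t.
Hypothesis p01 : 0 <= p <= 1.
Hypothesis n0 : (0 < n)%N.
Local Notation k := (size t).
Local Notation N := (n + size t)%N.
Implicit Types (w : {ffun upair n -> bool}) (v : 'I_n) (s : {perm 'I_N}).
(** At most 2 (k + 1) small neighbours before planting, and at most k new ones. *)
Local Notation D := (2 * k.+1 + k)%N.

Definition fertile (m0 : nat) w : {set 'I_n} :=
  [set v | [&& limb_free t (gnp_graph w) v, (m0 <= #|[set x | connect (gnp_graph w) v x]|)%N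
     & (#|small_nbrs (gnp_graph w) k.+1 v| <= 2 * k.+1)%N]].

Definition planted_limbs (m0 : nat) (z : {ffun upair N -> bool}) :=
  [set fu : {ffun 'I_k -> 'I_N} * 'I_N | lonely D (gnp_graph z) fu.1 fu.2 &
     (m0 <= #|[set x | connect (gnp_graph z) fu.2 x]|)%N].

(** Double counting of limbs against the vertices of their components: a limb sees at least [m0]
    vertices, a vertex at most [lonely_bound t D] limbs. *)
Lemma card_planted_limbs m0 z :
  (#|planted_limbs m0 z| * m0 <= N * lonely_bound t D)%N.
Proof.
rewrite -sum_nat_const.
apply: (@leq_trans (\sum_(fu in planted_limbs m0 z)
    \sum_(x : 'I_N) (connect (gnp_graph z) fu.2 x : nat))%N).
  apply: leq_sum => fu; rewrite inE => /andP[_ /leq_trans]; apply.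
  rewrite -sum1_card big_mkcond; apply: leq_sum => x _; rewrite inE.
  by case: connect.
rewrite exchange_big /= -[N in (N * _)%N]card_ord -sum_nat_const; apply: leq_sum => x _.
apply: leq_trans (card_lonely_component wft (@gnp_graph_sym _ z) x (_ : (k.+1 <= D)%N)); last by lia.
rewrite -[leqRHS]sum1_card big_mkcond [leqRHS]big_mkcond /=; apply: leq_sum => fu _.
rewrite !inE; case: (lonely D _ _ _) => //=; case: (m0 <= _)%N; case: connect => //.
Qed.

Lemma planted_lonely w v s m0 : v \in fertile m0 w ->
  ([ffun i => s (rshift n i)], s (lshift k v)) \in planted_limbs m0 (planted t w v s).
Proof.
rewrite !inE /= => /and3P[free sv small].
have gE := plantedE wft w v s.
apply/andP; split.
  have L := @lonely_plant t n (gnp_graph w) v D free.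
  have {}L := L ltac:(by rewrite leq_add2r).
  have := lonely_iso (permK s) (permKV s) gE L.
  congr (lonely _ _ _ _).
  by apply/ffunP => i; rewrite !ffunE.
apply: leq_trans sv _; rewrite -(card_imset _ (inj_comp (@perm_inj _ s) (@lshift_inj n k))).
apply/subset_leq_card/subsetP => _ /imsetP[x xv ->]; rewrite !inE in xv *.
apply: (connect_iso gE); exact: connect_plant.
Qed.

Lemma planted_inj w1 w2 v1 v2 s : planted t w1 v1 s = planted t w2 v2 s -> w1 = w2.
Proof.
move=> E; apply/ffunP => q; rewrite -!gnp_graph_lt.
rewrite -[LHS](plant_ll t _ v1) -[RHS](plant_ll t _ v2).
by rewrite -(plantedE wft w1 v1 s) -(plantedE wft w2 v2 s) E.
Qed.

(* The relabelling s determines w and v; only its values on the limb are prescribed by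
   the planted limb, whence the factor n`!. *)
Lemma card_planted_fiber m0 (z : {ffun upair N -> bool}) :
  (#|[set x : {ffun upair n -> bool} * 'I_n * {perm 'I_N} |
      (x.1.2 \in fertile m0 x.1.1) && (planted t x.1.1 x.1.2 x.2 == z)]|
   <= #|planted_limbs m0 z| * n`!)%N.
Proof.
set A := [set x | _].
pose h (x : {ffun upair n -> bool} * 'I_n * {perm 'I_N}) :=
  ([ffun i => x.2 (rshift n i)] : {ffun 'I_k -> 'I_N}, x.2 (lshift k x.1.2)).
have hA x : x \in A -> h x \in planted_limbs m0 z.
  rewrite inE => /andP[xf /eqP <-]; exact: planted_lonely.
have -> : A = \bigcup_(fu in planted_limbs m0 z) [set x in A | h x == fu].
  apply/setP => x; apply/idP/bigcupP => [xA|[fu _]]; last by rewrite inE => /andP[].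
  by exists (h x); [exact: hA|rewrite inE xA /=].
apply: leq_trans (card_bigcup_leq _ _) _; rewrite -sum_nat_const; apply: leq_sum => fu _.
apply: leq_trans (card_perm_prescribed fu.1).
set B := [set x in A | _].
have injB : {in B &, injective (@snd ({ffun upair n -> bool} * 'I_n) {perm 'I_N})}.
  move=> [[w1 v1] s1] [[w2 v2] s2]; rewrite !inE /= => /andP[/andP[_ /eqP E1] /eqP h1].
  case/andP => [/andP[_ /eqP E2] /eqP h2] Es; rewrite -{s2}Es in E2 h2 *.
  rewrite -E2 in E1; rewrite (planted_inj E1).
  by move: h1; rewrite -h2 => -[/perm_inj/lshift_inj ->].
rewrite -(card_in_imset injB); apply/subset_leq_card/subsetP => _ /imsetP[x xB ->].
rewrite inE; apply/forallP => i; move: xB; rewrite inE => /andP[_ /eqP <-].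
by rewrite /h ffunE.
Qed.

(** The total weight of the results of all plantings, computed in two ways: a planting multiplies
    the weight by [limb_prob] and has N! relabellings, while a given result arises at most n! times
    for each of its planted limbs. *)
Lemma planting_bound m0 :
  limb_prob t n p * N`!%:R * m0%:R *
    \sum_w gnp_weight p w * #|fertile m0 w|%:R
  <= n`!%:R * (N * lonely_bound t D)%:R.
Proof.
set c := limb_prob t n p.
have -> : c * N`!%:R * m0%:R * \sum_w gnp_weight p w * #|fertile m0 w|%:R =
   \sum_(x : {ffun upair n -> bool} * 'I_n * {perm 'I_N} | x.1.2 \in fertile m0 x.1.1)
      gnp_weight p (planted t x.1.1 x.1.2 x.2) * m0%:R.
  transitivity (\sum_w \sum_(v | v \in fertile m0 w) \sum_s
      gnp_weight p (planted t w v s) * m0%:R); last first.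
    rewrite pair_big_dep /=.
    rewrite (pair_big_dep (fun x : {ffun upair n -> bool} * 'I_n => x.2 \in fertile m0 x.1)
       (fun _ _ => true) (fun x s => gnp_weight p (planted t x.1 x.2 s) * m0%:R)) /=.
    by apply: eq_bigl => x; rewrite andbT.
  rewrite mulr_sumr; apply: eq_bigr => w _.
  have cP : #|{perm 'I_N}| = N`! by exact: card_Sn.
  rewrite (eq_bigr (fun=> gnp_weight p w * c * m0%:R *+ N`!)) => [|v _].
    rewrite sumr_const -[RHS]mulr_natr -(mulr_natr (_ * _ * _)).
    by move: (gnp_weight p w) c (N`!%:R) (m0%:R) (#|_|%:R) => a b d e f; ring.
  rewrite (eq_bigr (fun=> gnp_weight p w * c * m0%:R)) => [|s _].
    by rewrite sumr_const cP.
  by rewrite planted_weight.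
(* The plantings are now grouped by the resulting sample [z]. *)
rewrite (partition_big (fun x => planted t x.1.1 x.1.2 x.2) xpredT) //=.
apply: (@le_trans _ _ (\sum_(z : {ffun upair N -> bool}) gnp_weight p z * (n`!%:R * (N * lonely_bound t D)%:R))).
  apply: ler_sum => z _.
  rewrite (eq_bigr (fun=> gnp_weight p z * m0%:R)) => [|x /andP[_ /eqP ->] //].
  rewrite sumr_const -mulrnAr; apply: ler_wpM2l; first exact: gnp_weight_ge0.
  rewrite -mulr_natr -!natrM ler_nat.
  have H1 := card_planted_limbs m0 z; have H2 := card_planted_fiber m0 z.
  rewrite cardsE in H2; apply: leq_trans (leq_mul (leqnn m0) H2) _.
  by rewrite mulnA (mulnC m0) mulnC leq_mul2l H1 orbT.
by rewrite -mulr_suml sum_gnp_weight mul1r.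
Qed.

Definition barren_component m0 w : bool :=
  [exists x, (m0 <= #|[set y | connect (gnp_graph w) x y]|)%N && limb_free t (gnp_graph w) x].

(** At least half of the vertices of a barren component have few small neighbours, and these are
    fertile. *)
Lemma fertile_barren m0 w : barren_component m0 w -> (m0 <= 2 * #|fertile m0 w|)%N.
Proof.
case/existsP => x /andP[sx fx].
have cs := sym_connect_sym (@gnp_graph_sym _ w).
apply: leq_trans (sx) _; apply: leq_trans (card_good_vertices (@gnp_graph_sym _ w) x (isT : (0 < k.+1)%N)) _.
rewrite leq_mul2l /=; apply/subset_leq_card/subsetP => v; rewrite !inE => /andP[xv ->].
rewrite andbT; apply/andP; split.
  apply/forallP => f; apply/forallP => u; have := forallP fx f => /forallP/(_ u).
  apply: contra => /andP[-> /=]; exact: connect_trans.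
apply: leq_trans sx _; apply: subset_leq_card; apply/subsetP => y; rewrite !inE.
by apply: connect_trans; rewrite cs.
Qed.

(** Markov's inequality: a barren sample has at least m0 / 2 fertile vertices. *)
Lemma barren_bound m0 :
  limb_prob t n p * N`!%:R * m0%:R ^+ 2 *
    \sum_(w | barren_component m0 w) gnp_weight p w
  <= 2 * (n`!%:R * (N * lonely_bound t D)%:R).
Proof.
apply: le_trans (ler_wpM2l (ler0n _ 2) (planting_bound m0)).
set c := limb_prob t n p * N`!%:R.
have c0 : 0 <= c * m0%:R.
  by case/andP: p01 => p0 p1; rewrite !mulr_ge0 ?exprn_ge0 ?subr_ge0.
have -> : c * m0%:R ^+ 2 * \sum_(w | barren_component m0 w) gnp_weight p w =
  c * m0%:R * (m0%:R * \sum_(w | barren_component m0 w) gnp_weight p w) by ring.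
rewrite [leRHS]mulrCA; apply: ler_wpM2l => //.
rewrite !mulr_sumr big_mkcond; apply: ler_sum => w _.
have w0 := gnp_weight_ge0 w p01.
case: ifP => [/fertile_barren B|_]; last by rewrite !mulr_ge0.
rewrite mulrCA mulrC; apply: ler_wpM2l => //.
by rewrite -natrM ler_nat.
Qed.

End PlantingCount.

(** * Existence of a giant component *)

Section Cover.
Variables (R : realType) (n : nat) (p : R).
Hypothesis p01 : 0 <= p <= 1.
Implicit Types (U W : {set 'I_n}) (f : {ffun 'I_n -> 'I_n}).

(** The first two conditions concern the sample: parent edges are present and no edge leaves [W].
    The last two concern [f] alone; they make the parent edges distinct and different from the
    absent pairs. *)
Definition cover_event U W f (w : {ffun upair n -> bool}) : bool :=
  [&& [forall x in U, gnp_graph w x (f x)],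
      [forall x in W, forall y in ~: W, ~~ gnp_graph w x y],
      [forall x in U, (f x \in U) ==> (f (f x) != x)] & [forall x in U, f x \in W]].

(** The event prescribes |U| present and |W| (n - |W|) absent pairs, all distinct; if a condition on
    [f] fails, it is empty. *)
Lemma cover_event_bound U W f : U \subset W ->
  \sum_(w | cover_event U W f w) gnp_weight p w <=
    p ^+ #|U| * (1 - p) ^+ (#|W| * (n - #|W|)).
Proof.
move=> UW.
pose P1 := [set q | [exists x in U, upair_opt x (f x) == Some q]].
pose P0 := [set q | [exists x in W, exists y in ~: W, upair_opt x y == Some q]].
have [/forall_inP ok1 | ] := boolP [forall x in U, (f x \in U) ==> (f (f x) != x)]; last first.
  rewrite /cover_event => /negbTE ->; rewrite big_pred0 => [|w]; last by rewrite /= !andbF.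
  by case/andP: p01 => p0 p1; rewrite mulr_ge0 ?exprn_ge0 ?subr_ge0.
have [/forall_inP ok2 | ] := boolP [forall x in U, f x \in W]; last first.
  rewrite /cover_event => /negbTE ->; rewrite big_pred0 => [|w]; last by rewrite /= !andbF.
  by case/andP: p01 => p0 p1; rewrite mulr_ge0 ?exprn_ge0 ?subr_ge0.
have neq x : x \in U -> x != f x.
  move=> xU; apply/eqP => E; have := ok1 x xU; rewrite -E xU -E eqxx //.
have dis : [disjoint P1 & P0].
  rewrite -setI_eq0; apply/eqP/setP => q; rewrite !inE.
  apply/negbTE/negP => /andP[/exists_inP[x xU /eqP E1] /exists_inP[a aW /exists_inP[b]]].
  rewrite inE => bW /eqP; rewrite -E1 => /esym/(upair_opt_inj (neq x xU)).
  case=> -[Ea Eb]; move: bW; first by rewrite -Eb ok2.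
  by rewrite -Ea (subsetP UW).
have c1 : #|P1| = #|U|.
  have inj : {in U &, injective (fun x => upair_opt x (f x))}.
    move=> x y xU yU /= /(upair_opt_inj (neq x xU))[[//]|[xy yx]].
    by have := ok1 x xU; rewrite yx yU -xy eqxx.
  rewrite -(card_in_imset inj) -(card_imset _ (@Some_inj _)); apply: eq_card => o.
  apply/imsetP/imsetP => [[q]|[x xU ->]].
    by rewrite inE => /exists_inP[x xU /eqP E] ->; exists x.
  have [q E] := upair_opt_neq (neq x xU); exists q => //.
  by rewrite inE; apply/exists_inP; exists x; rewrite ?E.
have c0 : #|P0| = (#|W| * (n - #|W|))%N.
  have nW : (n - #|W| = #|~: W|)%N by have := cardsC W; rewrite card_ord => /(canRL (addKn _)) ->.
  have neqW a b : a \in W -> b \in ~: W -> a != b.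
    by rewrite inE => aW; apply: contraNneq => <-.
  have inj : {in finset.setX W (~: W) &, injective (fun z => upair_opt z.1 z.2)}.
    move=> [a b] [a' b'] /setXP[/= aW bW] /setXP[/= aW' bW'] /=.
    case/(upair_opt_inj (neqW _ _ aW bW)) => [[-> ->] //|[Ea Eb]].
    by move: bW; rewrite inE Eb aW'.
  rewrite nW -cardsX -(card_in_imset inj) -(card_imset _ (@Some_inj _)); apply: eq_card => o.
  apply/imsetP/imsetP => [[q]|[[x y] /setXP[/= xW yW] ->]].
    rewrite inE => /exists_inP[x xW /exists_inP[y yW /eqP E]] ->; exists (x, y) => //.
    exact/setXP.
  have [q E] := upair_opt_neq (neqW _ _ xW yW); exists q => //.
  by rewrite inE; apply/exists_inP; exists x => //; apply/exists_inP; exists y; rewrite ?E.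
rewrite -c1 -c0 -(gnp_cylinder p dis); apply: pr_le => // w /and4P[/forall_inP ev1 /forall_inP ev0 _ _].
apply/forallP => q; apply/andP; split; apply/implyP; rewrite inE.
  by case/exists_inP => x xU /eqP E; rewrite -(gnp_graph_opt w E) ev1.
case/exists_inP => x xW /exists_inP[y yW /eqP E]; rewrite -(gnp_graph_opt w E).
by have /forall_inP/(_ y yW) := ev0 x xW.
Qed.

Definition small_components (s : nat) (w : {ffun upair n -> bool}) : bool :=
  [forall x, #|[set y | connect (gnp_graph w) x y]| <= s]%N.

(* Dividing b by 'C(n, u) makes the sum over all sets U collapse to n + 1. *)
Lemma small_components_bound s (b : R) : (0 < n)%N -> (s <= n)%N ->
  (forall u m, (u <= m)%N -> (s <= m <= 2 * s)%N -> (m <= n)%N ->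
     m%:R ^+ u * (p ^+ u * (1 - p) ^+ (m * (n - m))) <= b / 'C(n, u)%:R) ->
  \sum_(w | small_components s w) gnp_weight p w <= n.+1%:R * (n.+1%:R * b).
Proof.
move=> n0 sn bP.
pose x0 := Ordinal n0.
have p0 : 0 <= p by case/andP: p01.
have q0 : 0 <= 1 - p by case/andP: p01; rewrite subr_ge0.
pose J := (fun (U : {set 'I_n}) (j : 'I_n.+1) => [disjoint U & low n j] && (s <= #|U :|: low n j| <= 2 * s)%N).
(* Union bound: a sample with small components satisfies the event for some [j], with [U] the
   explored vertices outside [low j] and [f] their breadth-first parents. *)
apply: (@le_trans _ _ (\sum_w \sum_(j : 'I_n.+1) \sum_(U | J U j)
    \sum_(f in pffun_on x0 (mem U) (mem (U :|: low n j)))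
       (if cover_event U (U :|: low n j) f w then gnp_weight p w else 0))).
  rewrite big_mkcond; apply: ler_sum => w _.
  have w0 := gnp_weight_ge0 w p01.
  have H0 j U f : 0 <= (if cover_event U (U :|: low n j) f w then gnp_weight p w else 0).
    by case: ifP.
  case: ifP => [/forallP small|_]; last by repeat (apply: sumr_ge0; move=> ? ?); exact: H0.
  have esym := @gnp_graph_sym _ w.
  have [j jn sj] := explored_size esym sn small.
  have [f [d fP]] := bfs_parent esym j.
  pose W := explored (gnp_graph w) j; pose U := W :\: low n j.
  (* The fixed value [x0] outside [U] makes [F] one of the |W|^|U| maps from [U] to [W]. *)
  pose F := [ffun x => if x \in U then f x else x0].
  have UW : U :|: low n j = W.
    apply/setP => y; rewrite in_setU in_setD; case: (boolP (y \in low n j)) => /= yl.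
      by rewrite (subsetP (low_explored (gnp_graph w) j) y yl).
    by rewrite orbF.
  rewrite (bigD1 (Ordinal (jn : (j < n.+1)%N))) //= (bigD1 U) /=; last first.
    rewrite /J /= UW sj andbT -setI_eq0; apply/eqP/setP => y; rewrite !inE.
    by case: (y < j)%N; rewrite ?andbF.
  have FU : F \in pffun_on x0 (mem U) (mem (U :|: low n j)).
    apply/pffun_onP; split.
      by apply/supportP => y yU; rewrite ffunE (negbTE yU).
    by move=> _ /imageP[y yU ->]; rewrite ffunE yU /= UW; have [] := fP y yU.
  rewrite (bigD1 F) //=.
  have -> : cover_event U (U :|: low n j) F w.
    rewrite UW; apply/and4P; split.
    - by apply/forall_inP => x xU; rewrite ffunE xU; have [] := fP x xU.
    - apply/forall_inP => x xW; apply/forall_inP => y; rewrite inE; apply: contra.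
      exact: explored_closed.
    - apply/forall_inP => x xU; rewrite !ffunE xU; apply/implyP => fU; rewrite fU.
      apply/eqP => E; have [_ _ d1] := fP x xU; have [_ _] := fP _ fU.
      by rewrite E ltnNge (ltnW d1).
    by apply/forall_inP => x xU; rewrite ffunE xU; have [] := fP x xU.
  rewrite -!addrA lerDl !addr_ge0 //; repeat (apply: sumr_ge0; move=> ? ?); exact: H0.
rewrite exchange_big /= -[X in _ <= X%:R * _](card_ord n.+1) -sum1_card natr_sum mulr_suml.
apply: ler_sum => j _; rewrite mul1r exchange_big /=.
apply: (@le_trans _ _ (\sum_(U : {set 'I_n}) b / 'C(n, #|U|)%:R)).
  rewrite big_mkcond; apply: ler_sum => U _.
  have b0 : 0 <= b.
    (* The case u = 0, m = s of the hypothesis has a nonnegative left-hand side. *)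
    have := bP 0%N s isT; rewrite leqnn mul2n -addnn leq_addr => /(_ isT sn).
    by rewrite bin0 divr1; apply: le_trans; rewrite !mulr_ge0 ?exprn_ge0.
  case: ifP => [/andP[disU sU]|_]; last by rewrite divr_ge0.
  rewrite exchange_big /=; set W := U :|: low n j.
  apply: (@le_trans _ _ (\sum_(f in pffun_on x0 (mem U) (mem W)) (p ^+ #|U| * (1 - p) ^+ (#|W| * (n - #|W|))))).
    apply: ler_sum => f _; rewrite -big_mkcond; apply: cover_event_bound; exact: subsetUl.
  rewrite sumr_const card_pffun_on -[leLHS]mulr_natl natrX; apply: bP => //.
    by apply: subset_leq_card; apply: subsetUl.
  by rewrite -[leqRHS]card_ord; apply: max_card.
rewrite (partition_big (fun U : {set 'I_n} => inord #|U| : 'I_n.+1) xpredT) //=.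
rewrite -[X in _ <= X%:R * _](card_ord n.+1) -sum1_card natr_sum mulr_suml.
apply: ler_sum => u _; rewrite mul1r.
have cU (U : {set 'I_n}) : (inord #|U| == u) = (#|U| == u).
  by rewrite -val_eqE /= inordK // ltnS -[leqRHS]card_ord; apply: max_card.
rewrite (eq_bigl _ _ cU) (eq_bigr (fun=> b / 'C(n, u)%:R)) => [|U /eqP -> //].
rewrite sumr_const -[X in 'C(X, u)](card_ord n) -card_draws.
rewrite (eq_card (_ : _ =i [set A : {set 'I_n} | #|A| == u])) => [|U]; last by rewrite !inE.
rewrite -[leLHS]mulr_natr mulfVK // pnatr_eq0 card_draws card_ord -lt0n bin_gt0.
by rewrite -ltnS.
Qed.

End Cover.

(** * Estimates *)

Section Estimates.
Variable R : realType.
Implicit Types (x c L : R).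

Lemma expR_ge_power x k : 0 <= x -> x ^+ k / k`!%:R <= expR x.
Proof.
move=> x0; case: k => [|k]; first by rewrite expr0 fact0 divr1 -expR0 ler_expR.
by apply: le_trans (expR_ge1Dxn k x0); rewrite lerDr.
Qed.

(** Applying ln s <= s - 1 to the square root s of c gives ln c <= 2 (s - 1) < s^2 - 1. *)
Lemma ln_lt_sub1 c : 1 < c -> ln c < c - 1.
Proof.
move=> c1; have c0 : 0 < c by lra.
have s1 : 1 < Num.sqrt c by rewrite -[X in X < _]sqrtr1 ltr_sqrt.
have := sqr_sqrtr (ltW c0); set s := Num.sqrt c in s1 *; move=> <-.
rewrite lnXn; last by lra.
have := @le_ln1Dx R (s - 1) ltac:(lra); rewrite addrC subrK => H.
rewrite -mulr_natr; nra.
Qed.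

Lemma ler_1B_expR x : 1 - x <= expR (- x).
Proof. by have := expR_ge1Dx (- x). Qed.

Lemma leq_ffact_exp n u : (n ^_ u <= n ^ u)%N.
Proof.
rewrite ffact_prod -[u in (n ^ u)%N]card_ord -prod_nat_const.
by apply: leq_prod => i _; apply: leq_subr.
Qed.

(** The logarithm of c e^(1 - c) is [- 2 * gap c]. *)
Definition gap c : R := (c - 1 - ln c) / 2.

Lemma gap_gt0 c : 1 < c -> 0 < gap c.
Proof. by move=> /ln_lt_sub1 H; rewrite /gap; lra. Qed.

(* The exponent is half of that in x e^(1 - x) <= c e^(1 - c), which leaves room for y. *)
Lemma gap_bound c (x y : R) : 1 < c -> c <= x -> y <= gap c / c ->
  x * expR (1 - x * (1 - y)) <= expR (- gap c).
Proof.
move=> c1 cx yg; have c0 : 0 < c by lra.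
have lnc : 0 <= ln c by apply: ln_ge0; lra.
(* The tangent bound x / c <= e^(x / c - 1), multiplied by c. *)
have E : x <= expR (ln c + x / c - 1).
  rewrite -addrA expRD lnK ?posrE //.
  have H : x / c <= expR (x / c - 1) by have := expR_ge1Dx (x / c - 1); lra.
  by rewrite -ler_pdivrMl // mulrC.
have cy : c * y <= gap c by rewrite mulrC -ler_pdivlMr.
apply: le_trans (ler_wpM2r (expR_ge0 _) E) _; rewrite -expRD ler_expR.
(* The exponent ln c - x (1 - y - 1 / c) decreases with x, so x = c is the worst case. *)
have : 0 <= (x - c) * (1 - y - c^-1).
  apply: mulr_ge0; first by lra.
  have : 0 <= c * (1 - y - c^-1).
    by rewrite mulrBr mulfV ?gt_eqF //; rewrite /gap in cy; nra.
  by rewrite pmulr_rge0.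
have cc : c * c^-1 = 1 by rewrite mulfV ?gt_eqF.
rewrite /gap in cy *; rewrite mulrBl mulrBr mulrBr [c * (_ - _)]mulrBr [c * (1 - y)]mulrBr cc; nra.
Qed.

(** With C(n, u) <= n^u / u! and m^u / u! <= e^m, the number of sets and parent maps times the
    probability is at most (lam e^(1 - lam (1 - m / n)))^m, to which [gap_bound] applies. *)
Lemma small_component_term c (lam : R) (n s u m : nat) :
  1 < c -> c <= lam -> (0 < n)%N -> lam <= n%:R ->
  2 * s%:R <= gap c / c * n%:R -> (u <= m)%N -> (s <= m <= 2 * s)%N -> (m <= n)%N ->
  m%:R ^+ u * ((lam / n%:R) ^+ u * (1 - lam / n%:R) ^+ (m * (n - m))) <=
   expR (- gap c) ^+ s / 'C(n, u)%:R.
Proof.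
move=> c1 clam n0 lamn sn um /andP[sm ms] mn.
have nR : 0 < n%:R :> R by rewrite ltr0n.
have lam0 : 0 < lam by lra.
set p := lam / n%:R.
have p0 : 0 <= p by rewrite divr_ge0 ?ltW.
have p1 : p <= 1 by rewrite ler_pdivrMr // mul1r.
pose y : R := m%:R / n%:R.
have yg : y <= gap c / c.
  rewrite ler_pdivrMr //; apply: le_trans sn.
  by rewrite -natrM ler_nat.
have H1 : (1 - p) ^+ (m * (n - m)) <= expR (- (lam * (1 - y))) ^+ m.
  have -> : - (lam * (1 - y)) = (n - m)%:R * (- p).
    by rewrite natrB // /p /y; field; rewrite gt_eqF.
  rewrite expRM_natl -exprM mulnC; apply: lerXn2r; rewrite ?nnegrE ?expR_ge0 ?subr_ge0 //.
  exact: ler_1B_expR.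
have C0 : 0 < 'C(n, u)%:R :> R by rewrite ltr0n bin_gt0 (leq_trans um).
have H2 : m%:R ^+ u * p ^+ u <= lam ^+ m * expR 1 ^+ m / 'C(n, u)%:R.
  have -> : expR 1 ^+ m = expR m%:R :> R by rewrite -expRM_natl mulr1.
  rewrite ler_pdivlMr // /p expr_div_n.
  have nu : 'C(n, u)%:R <= n%:R ^+ u / u`!%:R :> R.
    rewrite ler_pdivlMr ?ltr0n ?fact_gt0 // -natrM bin_ffact -natrX ler_nat.
    exact: leq_ffact_exp.
  apply: (@le_trans _ _ (m%:R ^+ u * (lam ^+ u / n%:R ^+ u) * (n%:R ^+ u / u`!%:R))).
    have [lamW nW] := (ltW lam0, ltW nR).
    by apply: ler_wpM2l => //; rewrite !mulr_ge0 ?exprn_ge0 ?invr_ge0 ?exprn_ge0.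
  have -> : m%:R ^+ u * (lam ^+ u / n%:R ^+ u) * (n%:R ^+ u / u`!%:R)
     = lam ^+ u * (m%:R ^+ u / u`!%:R).
    by field; rewrite expf_neq0 ?gt_eqF ?ltr0n ?fact_gt0.
  apply: ler_pM; rewrite ?divr_ge0 ?exprn_ge0 ?(ltW lam0) //; last exact: expR_ge_power.
  by apply: ler_weXn2l => //; lra.
rewrite mulrA; apply: le_trans (ler_pM _ _ H2 H1) _; rewrite ?mulr_ge0 ?exprn_ge0 ?subr_ge0 //.
have -> : lam ^+ m * expR 1 ^+ m / 'C(n, u)%:R * expR (- (lam * (1 - y))) ^+ m =
   (lam * expR (1 - lam * (1 - y))) ^+ m / 'C(n, u)%:R.
  by rewrite expRD !exprMn; ring.
apply: ler_wpM2r; first by rewrite invr_ge0 ltW.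
apply: (@le_trans _ _ (expR (- gap c) ^+ m)).
  by apply: lerXn2r; rewrite ?nnegrE ?mulr_ge0 ?expR_ge0 ?(ltW lam0) //; apply: gap_bound.
by apply: ler_wiXn2l => //; rewrite ?expR_ge0 ?expR_le1 ?oppr_le0 ?(ltW (gap_gt0 c1)).
Qed.

(** The exponential decay in s >= eps n beats the factor (n + 1)^2; the cubic term of the
    exponential series leaves a bound of order 1 / n. *)
Lemma small_components_prob c (lam : R) (n s : nat) (eps : R) :
  1 < c -> c <= lam -> (0 < n)%N -> lam <= n%:R -> 0 < eps ->
  2 * s%:R <= gap c / c * n%:R -> eps * n%:R <= s%:R -> (s <= n)%N ->
  \sum_(w : {ffun upair n -> bool} | small_components s w) gnp_weight (lam / n%:R) w
    <= 24 / ((gap c * eps) ^+ 3 * n%:R).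
Proof.
move=> c1 clam n0 lamn e0 s1 s2 sn.
have nR : 1 <= n%:R :> R by rewrite ler1n.
have p01 : 0 <= lam / n%:R <= 1.
  by rewrite divr_ge0 ?ler_pdivrMr ?mul1r /=; lra.
have g0 := gap_gt0 c1.
apply: le_trans (small_components_bound (b := expR (- gap c) ^+ s) p01 n0 sn _) _.
  by move=> u m um sm mn; apply: small_component_term.
rewrite -expRM_natl mulrN expRN.
set x := gap c * eps * n%:R.
have nR0 : 0 < n%:R :> R by rewrite ltr0n.
have x0 : 0 < x by do 2!apply: mulr_gt0 => //.
have xs : x <= s%:R * gap c by rewrite /x -mulrA mulrC ler_wpM2r // ltW.
have H : x ^+ 3 / 6 <= expR (s%:R * gap c).
  apply: le_trans (_ : expR x <= _); last by rewrite ler_expR.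
  exact: (@expR_ge_power x 3 (ltW x0)).
have n1 : n.+1%:R <= 2 * n%:R :> R by rewrite -natr1; lra.
have x3 : 0 < x ^+ 3 / 6 by rewrite divr_gt0 ?exprn_gt0.
apply: (@le_trans _ _ ((2 * n%:R) * (2 * n%:R * (x ^+ 3 / 6)^-1))).
  apply: ler_pM => //; apply: ler_pM => //.
  by rewrite lef_pV2 ?posrE // (lt_le_trans x3).
rewrite le_eqVlt; apply/orP; left; apply/eqP; rewrite /x; field.
by rewrite !gt_eqF //; lra.
Qed.

End Estimates.

(** * Probability of a large component without limb *)

Section BarrenEstimates.
Variable R : realType.
Implicit Types (x c p lam h : R).

(** For such p, 1 / (1 - p) <= 1 + p + 2 p^2 <= e^(p + 2 p^2). *)
Lemma expR_le_1B p : 0 <= p <= 1 / 2 -> expR (- (p + 2 * p ^+ 2)) <= 1 - p.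
Proof.
case/andP => p0 p1; rewrite expRN -[leRHS]invrK lef_pV2 ?posrE ?expR_gt0 ?invr_gt0 //; last by lra.
apply: le_trans (expR_ge1Dx _).
rewrite -[leLHS]mul1r ler_pdivrMr; last by lra.
nra.
Qed.

Lemma barren_prob (t : seq nat) (n s : nat) lam (eps : R) :
  wf_tree t -> (0 < n)%N -> (size t <= n)%N -> 1 <= lam -> lam <= n%:R / 2 ->
  lam ^+ 2 <= n%:R -> 0 < eps -> eps * n%:R <= s%:R ->
  \sum_(w : {ffun upair n -> bool} | barren_component t s w) gnp_weight (lam / n%:R) w
  <= 4 * (lonely_bound t (2 * (size t).+1 + size t))%:R * expR (2 * (size t)%:R + (size t)%:R ^+ 2)
       / eps ^+ 2 / (n%:R * lam ^+ size t * expR (- ((size t)%:R * lam))).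
Proof.
move=> wft n0 kn lam1 lamn lam2 e0 es.
set k := size t; set L := lonely_bound _ _; set p := lam / n%:R; set P := \sum_(w | _) _.
have nR : 1 <= n%:R :> R by rewrite ler1n.
have p0 : 0 <= p by rewrite divr_ge0 //; lra.
have p1 : p <= 1 / 2 by rewrite ler_pdivrMr; lra.
have pn : p * n%:R = lam by rewrite /p mulfVK // gt_eqF //; lra.
have p01 : 0 <= p <= 1 by rewrite p0 /=; lra.
have P0 : 0 <= P by apply: sumr_ge0 => w _; apply: gnp_weight_ge0.
set E := expR (2 * k%:R + k%:R ^+ 2).
set G := n%:R * lam ^+ k * expR (- (k%:R * lam)).
have E0 : 0 < E by apply: expR_gt0.
have G0 : 0 < G by rewrite !mulr_gt0 ?exprn_gt0 ?expR_gt0 //; lra.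
(* Up to the constant [E], the planting factor is at least lam^k e^(- k lam) / n^k: the exponent of
   1 - p is at most k n + k^2, and p lam <= 1 bounds the second-order terms. *)
have qb : lam ^+ k * expR (- (k%:R * lam)) / E <= limb_prob t n p * n%:R ^+ k.
  rewrite /limb_prob -/k [leRHS]mulrAC -exprMn pn -mulrA.
  apply: ler_wpM2l; first by rewrite exprn_ge0 //; lra.
  rewrite /E -expRN -expRD; set M := (_ - k)%N.
  apply: (@le_trans _ _ (expR (- (p + 2 * p ^+ 2)) ^+ M)); last first.
    by apply: lerXn2r; rewrite ?nnegrE ?expR_ge0 ?expR_le_1B ?p0 //=; lra.
  rewrite -expRM_natl ler_expR mulrN -opprD lerN2.
  have M1 : M%:R <= k%:R * n%:R + k%:R ^+ 2 :> R.
    rewrite -natrX -natrM -natrD ler_nat /M leq_subLR.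
    have : ((k * k.-1)./2 <= k * k)%N.
      by apply: leq_trans (leq_mul (leqnn k) (leq_pred k)); rewrite -divn2 leq_div.
    by rewrite -mulnn addnCA leq_add2l => /leq_trans; apply; apply: leq_addl.
  have k0 : 0 <= k%:R :> R by [].
  have pp : 0 <= p + 2 * p ^+ 2 by nra.
  have pp1 : p + 2 * p ^+ 2 <= 1 by nra.
  apply: le_trans (ler_wpM2r pp M1) _.
  have pl : p * lam <= 1.
    by rewrite /p mulrAC -expr2 ler_pdivrMr ?mul1r //; lra.
  have -> : (k%:R * n%:R + k%:R ^+ 2) * (p + 2 * p ^+ 2) =
    k%:R * (p * n%:R) + 2 * k%:R * (p * (p * n%:R)) + k%:R ^+ 2 * (p + 2 * p ^+ 2) by ring.
  rewrite pn.
  have : k%:R ^+ 2 * (p + 2 * p ^+ 2) <= k%:R ^+ 2 by rewrite ler_piMr ?exprn_ge0.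
  have : 2 * k%:R * (p * lam) <= 2 * k%:R by rewrite ler_piMr // mulr_ge0.
  lra.
have := barren_bound wft p01 n0 s; rewrite -/k -/L -/P => B.
have f0 : 0 < n`!%:R :> R by rewrite ltr0n fact_gt0.
have q0 : 0 <= limb_prob t n p.
  by apply: mulr_ge0; apply: exprn_ge0 => //; lra.
(* The quotient N! / n! is at least n^k. *)
have B2 : limb_prob t n p * n%:R ^+ k * s%:R ^+ 2 * P <= 2 * ((n + k) * L)%:R.
  rewrite -(ler_pM2l f0); apply: le_trans (_ : _ <= 2 * (n`!%:R * ((n + k) * L)%:R)) _; last first.
    by rewrite le_eqVlt; apply/orP; left; apply/eqP; ring.
  apply: le_trans B.
  have -> : n`!%:R * (limb_prob t n p * n%:R ^+ k * s%:R ^+ 2 * P) =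
    limb_prob t n p * (n`! * n ^ k)%:R * s%:R ^+ 2 * P by rewrite natrM natrX; ring.
  apply: ler_wpM2r => //; apply: ler_wpM2r; first exact: exprn_ge0.
  by apply: ler_wpM2l => //; rewrite ler_nat leq_fact_exp.
(* With s >= eps n and n + k <= 2 n a factor n is gained, the one in [G]. *)
have B3 : G / E * eps ^+ 2 * P * n%:R <= 4 * L%:R * n%:R.
  apply: le_trans (_ : limb_prob t n p * n%:R ^+ k * s%:R ^+ 2 * P <= _).
    have -> : G / E * eps ^+ 2 * P * n%:R =
      (lam ^+ k * expR (- (k%:R * lam)) / E) * (eps * n%:R) ^+ 2 * P by rewrite /G; ring.
    apply: ler_wpM2r => //; apply: ler_pM => //.
    - apply: divr_ge0; last exact: ltW.
      by apply: mulr_ge0; [apply: exprn_ge0; lra | exact: expR_ge0].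
    - by apply/exprn_ge0/mulr_ge0 => //; apply: ltW.
    by apply: lerXn2r; rewrite ?nnegrE //; apply: mulr_ge0 => //; apply: ltW.
  apply: le_trans B2 _; rewrite natrM natrD.
  have : k%:R <= n%:R :> R by rewrite ler_nat.
  have : 0 <= L%:R :> R by [].
  nra.
have nR0 : 0 < n%:R :> R by lra.
rewrite (ler_pM2r nR0) in B3.
rewrite ler_pdivlMr // ler_pdivlMr ?exprn_gt0 // -ler_pdivrMr //.
by apply: le_trans B3; rewrite le_eqVlt; apply/orP; left; apply/eqP; ring.
Qed.

(** In the application [L] is ln n. If k lam <= L / 2, the product is at least e^(L / 2). Otherwise
    lam > L / (2 k), the upper bound on lam gives e^(- k lam) >= e^(- L) L^(- k) e^(k h), and the
    product is at least h / (2 k)^k. *)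
Lemma limb_growth (k : nat) lam (L h A : R) : (0 < k)%N -> 1 <= lam -> 0 < L ->
  lam <= L / k%:R + ln L - h -> 0 <= h -> A <= L / 2 -> A * (2 * k%:R) ^+ k <= h ->
  A <= expR L * lam ^+ k * expR (- (k%:R * lam)).
Proof.
move=> k0 lam1 L0 lamL h0 AL Ah.
have kR : 0 < k%:R :> R by rewrite ltr0n.
have [lamk|lamk] := leP (k%:R * lam) (L / 2).
  apply: le_trans AL _; rewrite mulrAC -expRD.
  apply: le_trans (_ : expR (L / 2) <= _).
    by have := expR_ge1Dx (L / 2); lra.
  rewrite -[leLHS]mulr1; apply: ler_pM; rewrite ?expR_ge0 //.
    by rewrite ler_expR; lra.
  exact: exprn_ege1.
have c0 : 0 < (2 * k%:R) ^+ k :> R by rewrite exprn_gt0 // mulr_gt0.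
rewrite -(ler_pM2r c0); apply: le_trans Ah _.
have e1 : expR (- L) * L ^- k * expR (k%:R * h) <= expR (- (k%:R * lam)).
  have -> : L ^- k = expR (- (k%:R * ln L)).
    by rewrite expRN expRM_natl lnK ?posrE.
  rewrite -!expRD ler_expR.
  have : k%:R * lam <= k%:R * (L / k%:R + ln L - h) by apply: ler_wpM2l.
  have -> : k%:R * (L / k%:R + ln L - h) = L + k%:R * ln L - k%:R * h.
    by field; rewrite gt_eqF.
  lra.
have hk : h <= expR (k%:R * h).
  apply: le_trans (_ : k%:R * h <= _); first by rewrite ler_peMl // ler1n.
  by have := expR_ge1Dx (k%:R * h); lra.
apply: le_trans hk _.
have -> : expR L * lam ^+ k * expR (- (k%:R * lam)) * (2 * k%:R) ^+ k =
   (2 * (k%:R * lam)) ^+ k * (expR L * expR (- (k%:R * lam))).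
  by rewrite !exprMn; ring.
apply: le_trans (_ : L ^+ k * (expR L * (expR (- L) * L ^- k * expR (k%:R * h))) <= _).
  rewrite expRN le_eqVlt; apply/orP; left; apply/eqP; field.
  by rewrite expf_neq0 ?gt_eqF ?expR_gt0.
have Lk : L ^+ k <= (2 * (k%:R * lam)) ^+ k.
  by apply: lerXn2r; rewrite ?nnegrE ?ltW //; lra.
apply: ler_pM => //; rewrite ?exprn_ge0 ?(ltW L0) ?mulr_ge0 ?expR_ge0 ?invr_ge0 ?exprn_ge0 ?(ltW L0) //.
by apply: ler_wpM2l => //; apply: expR_ge0.
Qed.

End BarrenEstimates.

(** * A limb in the giant component with high probability *)

Definition limbed_giant (t : seq nat) (n : nat) (w : {ffun upair n -> bool}) : Prop :=
  forall C, is_largest_component (gnp_graph w) C ->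
    ((size t).+1 < #|C|)%N /\
    exists f : {ffun 'I_(size t) -> 'I_n}, exists2 u, limb (gnp_graph w) f u & u \in C.

(** A largest component is at least as large as the one exceeding [s], so it cannot be limb-free. *)
Lemma limbed_giantP (t : seq nat) (n s : nat) (w : {ffun upair n -> bool}) :
  ((size t).+1 < s)%N -> ~~ small_components s w -> ~~ barren_component t s w ->
  limbed_giant t w.
Proof.
move=> ks /forallPn[x]; rewrite -ltnNge => sx barren C [[y ->] Cmax].
have sC : (s < #|[set z | connect (gnp_graph w) y z]|)%N.
  by apply: leq_trans sx (Cmax _ _); exists x.
split; first exact: ltn_trans sC.
move: barren; rewrite negb_exists => /forallP/(_ y); rewrite (ltnW sC) /=.
rewrite negb_forall => /existsP[f]; rewrite negb_forall => /existsP[u].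
by rewrite negbK => /andP[L c]; exists f, u => //; rewrite inE.
Qed.

Section Whp.
Variable R : realType.
Implicit Types (lam h : R).

Lemma gnp_prob_le1 (n : nat) (p : R) (P : rel 'I_n -> Prop) : 0 <= p <= 1 ->
  gnp_prob p P <= 1.
Proof.
move=> p01; rewrite -(sum_gnp_weight n p) /gnp_prob; apply: ler_sum => w _.
by case: ifP => // _; apply: gnp_weight_ge0.
Qed.

Lemma gnp_prob_ge (t : seq nat) (n s : nat) (p : R) (P : rel 'I_n -> Prop) :
  0 <= p <= 1 -> ((size t).+1 < s)%N ->
  (forall w, limbed_giant t w -> P (gnp_graph w)) ->
  1 - \sum_(w : {ffun upair n -> bool} | small_components s w) gnp_weight p w
    - \sum_(w : {ffun upair n -> bool} | barren_component t s w) gnp_weight p w <= gnp_prob p P.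
Proof.
move=> p01 ks HP; rewrite !lerBlDr -(sum_gnp_weight n p) /gnp_prob.
rewrite [X in _ <= _ + X]big_mkcond [X in _ <= _ + X + _]big_mkcond -!big_split /=.
apply: ler_sum => w _; have w0 := gnp_weight_ge0 w p01.
have [sm|sm] := boolP (small_components s w); have [ba|ba] := boolP (barren_component t s w);
  case: asboolP => // nP; rewrite ?addr0 ?add0r ?lerDl ?lerDr ?addr_ge0 //.
by case: nP; apply: HP; apply: limbed_giantP ba.
Qed.

(** A single threshold [A] on ln n and [h] keeps the estimates apart from the limit. *)
Lemma limb_whp_aux (t : seq nat) (c delta : R) : wf_tree t -> (0 < size t)%N ->
  1 < c -> 0 < delta -> exists A : R, forall (n : nat) lam h (P : rel 'I_n -> Prop),
  A <= ln (n%:R : R) -> A <= h -> c <= lam ->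
  lam <= ln (n%:R : R) / (size t)%:R + ln (ln (n%:R : R)) - h ->
  (forall w, limbed_giant t w -> P (gnp_graph w)) ->
  1 - delta <= gnp_prob (lam / n%:R) P <= 1.
Proof.
move=> wft k0 c1 d0; set k := size t in k0 *.
have g0 := gap_gt0 c1.
have c0 : 0 < c by lra.
(* With s the integer part of e0 n, 2 s <= (gap c / c) n; the second halving absorbs the
   rounding. *)
pose e0 := gap c / c / 2; pose eps := e0 / 2.
have e0_gt0 : 0 < e0 by do 2!apply: divr_gt0 => //.
have eps0 : 0 < eps by rewrite /eps divr_gt0.
have e1 : e0 <= 1.
  rewrite /e0 ler_pdivrMr // mul1r ler_pdivrMr // /gap.
  have : 0 <= ln c by apply: ln_ge0; lra.
  lra.
pose K : R := 4 * (lonely_bound t (2 * k.+1 + k))%:R * expR (2 * k%:R + k%:R ^+ 2) / eps ^+ 2.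
have K0 : 0 <= K.
  apply: divr_ge0; last exact: exprn_ge0 (ltW eps0).
  by apply: mulr_ge0; [apply: mulr_ge0|apply: expR_ge0].
(* This gives K / A1 <= delta / 2; the summand 1 keeps [A1] positive. *)
pose A1 := (K + 1) * 2 / delta.
have A1_gt0 : 0 < A1 by rewrite /A1 divr_gt0 // mulr_gt0 //; lra.
pose A2 := 24 * 2 / (delta * (gap c * eps) ^+ 3).
have ge3 : 0 < (gap c * eps) ^+ 3 by apply/exprn_gt0/mulr_gt0.
have A2_gt0 : 0 < A2 by rewrite /A2 divr_gt0 // mulr_gt0.
have k2 : 1 <= (2 * k%:R) ^+ k :> R.
  have k1 : 1 <= k%:R :> R by rewrite ler1n.
  by apply: exprn_ege1; lra.
(* In order: 4 L^2 <= L^3 / 6 <= n for L = ln n; k <= n; k + 1 < s; e0 n >= 2 for the rounding; the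
   two conditions of [limb_growth]; the bound on small components. *)
exists (24 + k%:R + (k.+2)%:R / eps + 2 / e0 + 2 * A1 + A1 * (2 * k%:R) ^+ k + A2).
move=> n lam h P; set L := ln (n%:R : R) => AL Ah clam lamL HP.
have Ac : 0 <= k%:R :> R by [].
have Ac1 : 0 < k.+2%:R / eps :> R by rewrite divr_gt0.
have Ac2 : 0 < 2 / e0 by rewrite divr_gt0.
have Ac3 : 0 < A1 * (2 * k%:R) ^+ k by rewrite mulr_gt0 //; lra.
have n0 : (0 < n)%N.
  case: (n) @L AL {lamL HP P} => // L; rewrite /L ln0 //; lra.
have nR : 0 < n%:R :> R by rewrite ltr0n.
have L24 : 24 <= L by lra.
have nL : n%:R = expR L by rewrite lnK ?posrE.
have n1 : 1 + L <= n%:R by rewrite nL; apply: expR_ge1Dx.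
have n3 : L ^+ 3 / 6 <= n%:R by rewrite nL; apply: (@expR_ge_power _ L 3); lra.
have n2 : 4 * L ^+ 2 <= n%:R.
  apply: le_trans n3; rewrite ler_pdivlMr // exprSr; nra.
have lnL : ln L <= L by apply: ltW; apply: ln_sublinear; lra.
have kL : L / k%:R <= L.
  by rewrite ler_pdivrMr ?ltr0n // ler_peMr ?ler1n //; lra.
have lam2L : lam <= 2 * L by lra.
have lamn : lam <= n%:R / 2 by nra.
have lamsq : lam ^+ 2 <= n%:R by apply: le_trans n2; nra.
have p01 : 0 <= lam / n%:R <= 1.
  by rewrite divr_ge0 ?ler_pdivrMr ?mul1r //=; lra.
apply/andP; split; last exact: gnp_prob_le1.
pose s := Num.truncn (e0 * n%:R).
have en0 : 0 <= e0 * n%:R by rewrite mulr_ge0 ?ltW.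
have /andP[s1 s2] := truncn_itv en0; rewrite -/s in s1 s2.
have en2 : 2 <= e0 * n%:R.
  have : 2 / e0 <= n%:R by lra.
  by rewrite ler_pdivrMr // mulrC.
have s3 : eps * n%:R <= s%:R.
  have -> : eps * n%:R = e0 * n%:R / 2 by rewrite /eps; ring.
  by rewrite -natr1 in s2; lra.
have ks : (k.+1 < s)%N.
  rewrite -(ler_nat R); apply: le_trans s3.
  have : k.+2%:R / eps <= n%:R by lra.
  by rewrite ler_pdivrMr // mulrC.
have sn : (s <= n)%N.
  by rewrite -(ler_nat R); apply: le_trans s1 _; rewrite ler_piMl // ltW.
have kn : (k <= n)%N by rewrite -(ler_nat R); lra.
have B1 : \sum_(w : {ffun upair n -> bool} | small_components s w) gnp_weight (lam / n%:R) w <= delta / 2.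
  apply: le_trans (small_components_prob c1 clam n0 _ eps0 _ s3 sn) _.
  - by lra.
  - have -> : gap c / c * n%:R = 2 * (e0 * n%:R) by rewrite /e0; field; rewrite gt_eqF.
    by rewrite ler_pM2l.
  rewrite ler_pdivrMr; last exact: mulr_gt0.
  have : A2 <= n%:R by lra.
  rewrite /A2 ler_pdivrMr; last exact: mulr_gt0.
  move: ((gap c * eps) ^+ 3) => g H; lra.
have B2 : \sum_(w : {ffun upair n -> bool} | barren_component t s w) gnp_weight (lam / n%:R) w <= delta / 2.
  apply: le_trans (barren_prob wft n0 kn _ lamn lamsq eps0 s3) _; first by lra.
  rewrite -/k -/K.
  have G : A1 <= n%:R * lam ^+ k * expR (- (k%:R * lam)).
    rewrite nL; apply: (@limb_growth _ k lam L h) => //; lra.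
  rewrite ler_pdivrMr; last exact: lt_le_trans G.
  apply: le_trans (_ : delta / 2 * A1 <= _).
    rewrite /A1; have -> : delta / 2 * ((K + 1) * 2 / delta) = K + 1 by field; rewrite gt_eqF.
    lra.
  by rewrite ler_pM2l // divr_gt0.
have := gnp_prob_ge p01 ks HP; lra.
Qed.

End Whp.

(** * Cospectrality *)

(** The characteristic matrices are intertwined as well; take determinants and cancel that of
    [P]. *)
Lemma intertwined_char_poly (F : fieldType) n (A B P Q : 'M[F]_n) :
  A *m P = P *m B -> P *m Q = 1%:M -> char_poly A = char_poly B.
Proof.
move=> AP PQ; have Pu : P \in unitmx by case/mulmx1_unit: PQ.
pose P' := map_mx polyC P.
have E : char_poly_mx A *m P' = P' *m char_poly_mx B.
  rewrite /char_poly_mx mulmxBl mulmxBr /P' -!map_mxM AP; congr (_ - _).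
  by rewrite mul_scalar_mx mul_mx_scalar.
have := congr1 determinant E; rewrite !det_mulmx mulrC => /mulfI; apply.
by rewrite det_map_mx polyC_eq0 -unitfE -unitmxE.
Qed.

Section FunctionMatrix.
Variable F : fieldType.

(** Indexing by vertices turns matrix products into sums over the finite type itself. *)
Definition fun_mx (T T' : finType) (P : T -> T' -> F) : 'M[F]_(#|T|, #|T'|) :=
  \matrix_(i, j) P (enum_val i) (enum_val j).

Lemma fun_mx_mul (T T' T'' : finType) (P : T -> T' -> F) (Q : T' -> T'' -> F) :
  fun_mx P *m fun_mx Q = fun_mx (fun x z => \sum_y P x y * Q y z).
Proof.
apply/matrixP => i j; rewrite !mxE [RHS](reindex_onto enum_val enum_rank) => [|y _] /=; last exact: enum_rankK.
by apply: eq_big => [l|l _]; rewrite ?mxE // enum_valK eqxx.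
Qed.

Lemma fun_mx1 (T : finType) : fun_mx (fun x y : T => (x == y)%:R) = 1%:M.
Proof. by apply/matrixP => i j; rewrite !mxE (inj_eq enum_val_inj). Qed.

Lemma intertwined_fun_mx (T T' : finType) (A : T -> T -> F) (B : T' -> T' -> F)
    (P : T -> T' -> F) (Q : T' -> T -> F) : #|T| = #|T'| ->
  (forall x z, \sum_y A x y * P y z = \sum_y P x y * B y z) ->
  (forall x z, \sum_y P x y * Q y z = (x == z)%:R) ->
  char_poly (fun_mx A) = char_poly (fun_mx B).
Proof.
move=> TT' AP PQ.
have E1 : fun_mx A *m fun_mx P = fun_mx P *m fun_mx B.
  by rewrite !fun_mx_mul; apply/matrixP => i j; rewrite !mxE AP.
have E2 : fun_mx P *m fun_mx Q = 1%:M.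
  by rewrite fun_mx_mul -fun_mx1; apply/matrixP => i j; rewrite !mxE PQ.
(* The matrices are generalised because their types depend on the cardinalities, which are then
   identified. *)
move: (fun_mx A) (fun_mx P) (fun_mx B) (fun_mx Q) E1 E2.
move: TT'; case: _ / => A' P' B' Q' E1 E2.
exact: intertwined_char_poly E1 E2.
Qed.

End FunctionMatrix.

Lemma cospectral_intertwined (T T' : finType) (e : rel T) (e' : rel T') (P : T -> T' -> algC) (Q : T' -> T -> algC) :
  #|T| = #|T'| ->
  (forall x z, \sum_y (e x y)%:R * P y z = \sum_y P x y * (e' y z)%:R) ->
  (forall x z, \sum_y P x y * Q y z = (x == z)%:R) -> cospectral e e'.
Proof.
move=> TT' eP PQ; rewrite /cospectral /spectrum.
have -> : adjmx e = fun_mx (fun x y => (e x y)%:R) by [].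
by rewrite (intertwined_fun_mx TT' eP PQ).
Qed.

(** * Transfer of mates to ordinals *)

Section Mates.
Variables (T : finType) (e : rel T).

Definition ord_graph (e' : rel T) : rel 'I_#|T| :=
  fun i j => e' (enum_val i) (enum_val j).

(** The permutation matrix of the enumeration intertwines the two graphs. *)
Lemma cospectral_ord_graph (e' : rel T) : cospectral e' (ord_graph e').
Proof.
apply: (@cospectral_intertwined _ _ _ _ (fun x i => (x == enum_val i)%:R) (fun i x => (enum_val i == x)%:R)).
- by rewrite card_ord.
- move=> x i; rewrite (bigD1 (enum_val i)) //= eqxx mulr1 big1 ?addr0 => [|y /negbTE ->]; last by rewrite mulr0.
  rewrite (bigD1 (enum_rank x)) //= enum_rankK eqxx mul1r big1 ?addr0 => [|j jx].
    by rewrite /ord_graph enum_rankK.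
  suff /negbTE -> : x != enum_val j by rewrite mul0r.
  by apply: contraNneq jx => ->; rewrite enum_valK.
move=> x z; rewrite (bigD1 (enum_rank x)) //= enum_rankK eqxx mul1r big1 ?addr0 // => j jx.
suff /negbTE -> : x != enum_val j by rewrite mul0r.
by apply: contraNneq jx => ->; rewrite enum_valK.
Qed.

Lemma gcompl_ord_graph (e' : rel T) : gcompl (ord_graph e') = ord_graph (gcompl e').
Proof.
by apply/funext => i; apply/funext => j; rewrite /gcompl /ord_graph (inj_eq enum_val_inj).
Qed.

Lemma simple_ord_graph (e' : rel T) : simple_graph e' -> simple_graph (ord_graph e').
Proof. by case=> s i; split=> [x y|x]; [apply: s|apply: i]. Qed.

Lemma iso_ord_graph (e' : rel T) : graph_iso e (ord_graph e') -> graph_iso e e'.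
Proof.
case=> g [gb gE]; exists (fun x => enum_val (g x)); split=> [|x y]; last exact: gE.
exact: bij_comp (Bijective enum_valK enum_rankK) gb.
Qed.

Lemma mate_intro (e' : rel T) : simple_graph e' -> ~ graph_iso e e' ->
  cospectral e e' -> has_cospectral_mate e.
Proof.
move=> s ni c; exists (ord_graph e'); split; first exact: simple_ord_graph.
  by move/iso_ord_graph.
by rewrite /cospectral -cospectral_ord_graph.
Qed.

Lemma Rmate_intro (e' : rel T) : simple_graph e' -> ~ graph_iso e e' ->
  cospectral e e' -> cospectral (gcompl e) (gcompl e') -> has_Rcospectral_mate e.
Proof.
move=> s ni c cc; exists (ord_graph e'); split; first exact: simple_ord_graph.
- by move/iso_ord_graph.
- by rewrite /cospectral -cospectral_ord_graph.
by rewrite gcompl_ord_graph /cospectral -cospectral_ord_graph.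
Qed.

End Mates.

(* A matrix whose row and column sums are 1 commutes with the all-ones matrix,
   hence it intertwines the complements as well. *)
Lemma cospectral_gcompl (T : finType) (e e' : rel T) (P Q : T -> T -> algC) :
  irreflexive e -> irreflexive e' ->
  (forall x z, \sum_y (e x y)%:R * P y z = \sum_y P x y * (e' y z)%:R) ->
  (forall x z, \sum_y P x y * Q y z = (x == z)%:R) ->
  (forall x, \sum_y P x y = 1) -> (forall z, \sum_y P y z = 1) ->
  cospectral (gcompl e) (gcompl e').
Proof.
move=> ie ie' eP PQ P1 P1'; apply: (cospectral_intertwined _ _ PQ) => // x z.
have gE (g : rel T) : irreflexive g -> forall a b, (gcompl g a b)%:R = 1 - (a == b)%:R - (g a b)%:R :> algC.
  move=> ig a b; rewrite /gcompl; case: eqVneq => [->|_]; first by rewrite ig subrr subr0.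
  by case: (g a b); rewrite ?subr0 ?subrr.
under eq_bigr => y _ do rewrite gE // 2!mulrBl mul1r.
under [RHS]eq_bigr => y _ do rewrite gE // 2!mulrBr mulr1.
rewrite 2!sumrB P1' eP 2!sumrB P1; congr (_ - _ - _).
rewrite (bigD1 x) //= eqxx mul1r big1 ?addr0 => [|y yx]; last by rewrite eq_sym (negbTE yx) mul0r.
by rewrite (bigD1 z) //= eqxx mulr1 big1 ?addr0 // => y yz; rewrite (negbTE yz) mulr0.
Qed.

(** The integer counterpart of [nsum], again for evaluation. *)
Definition isum (k : nat) (F : nat -> int) : int := foldr (fun i s => F i + s) 0 (iota 0 k).

Lemma isumE k (F : nat -> int) : \sum_(i < k) F i = isum k F.
Proof.
rewrite -(big_mkord xpredT F) /index_iota subn0 /isum.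
by elim: (iota 0 k) => [|a s IH]; rewrite ?big_nil // big_cons IH.
Qed.

Definition entry (M : seq (seq int)) (i j : nat) : int := nth 0 (nth [::] M i) j.

(* [M / d] is an orthogonal matrix that intertwines the trees tA and tB with their roots
   removed and exchanges their attachment vectors. *)
Definition rotation (k : nat) (tA tB : seq nat) (M : seq (seq int)) (d : int) : bool :=
  (d != 0) && all (fun i =>
    [&& isum k (fun l => entry M i l * (troot tB l : nat)%:Z) == d * (troot tA i : nat)%:Z,
        isum k (fun l => (troot tA l : nat)%:Z * entry M l i) == d * (troot tB i : nat)%:Z &
      all (fun j =>
        (isum k (fun l => (tadj tA i l : nat)%:Z * entry M l j) ==
         isum k (fun l => entry M i l * (tadj tB l j : nat)%:Z))
        && (isum k (fun l => entry M i l * entry M j l) == d * d * ((i == j : nat)%:Z)))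
      (iota 0 k)]) (iota 0 k).

(* [M / d] fixes the all-ones vector, on both sides. *)
Definition stochastic (k : nat) (M : seq (seq int)) (d : int) : bool :=
  all (fun i => (isum k (fun l => entry M i l) == d) &&
                (isum k (fun l => entry M l i) == d)) (iota 0 k).

(** * Extending the rotation to the whole graph *)

Section Rotation.
Variables (k : nat) (T : finType) (f : {ffun 'I_k -> T}) (u : T) (e : rel T).
Hypotheses (finj : injective f) (fu : forall i, f i != u).
Hypotheses (es : symmetric e) (ei : irreflexive e).
Variables (tA tB : seq nat) (M : seq (seq int)) (d : int).
Hypotheses (rot : rotation k tA tB M d) (at_e : attached f u tA e).
Local Notation S := (f @: [set: 'I_k]).

Let m (i j : nat) : algC := (entry M i j)%:~R / d%:~R.

Let d0 : d%:~R != 0 :> algC.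
Proof. by rewrite intr_eq0; case/andP: rot. Qed.

Let m_isum (F : nat -> int) (c : int) :
  isum k F = d * c -> \sum_(l < k) (F l)%:~R / d%:~R = c%:~R :> algC.
Proof.
by move=> E; rewrite -mulr_suml -rmorph_sum /= isumE E intrM mulrAC mulfV ?mul1r.
Qed.

Let rotP (i : 'I_k) : [/\ \sum_(l < k) m i l * (troot tB l)%:R = (troot tA i)%:R,
   \sum_(l < k) (troot tA l)%:R * m l i = (troot tB i)%:R &
   forall j : 'I_k, \sum_(l < k) (tadj tA i l)%:R * m l j = \sum_(l < k) m i l * (tadj tB l j)%:R
     /\ \sum_(l < k) m i l * m j l = (i == j)%:R].
Proof.
have io (j : 'I_k) : val j \in iota 0 k by rewrite mem_iota /=.
case/andP: rot => _ /allP/(_ _ (io i))/and3P[/eqP H1 /eqP H2 /allP H3].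
have mE (b : bool) x : m x.1 x.2 * b%:R = (entry M x.1 x.2 * (b : nat)%:Z)%:~R / d%:~R.
  by rewrite intrM mulrAC.
split.
- rewrite (eq_bigr (fun l : 'I_k => (entry M i l * (troot tB l : nat)%:Z)%:~R / d%:~R)).
    by rewrite (m_isum H1).
  by move=> l _; rewrite (mE _ (_, _)).
- rewrite (eq_bigr (fun l : 'I_k => ((troot tA l : nat)%:Z * entry M l i)%:~R / d%:~R)).
    by rewrite (m_isum H2).
  by move=> l _; rewrite intrM -mulrA.
move=> j; have /andP[/eqP H4 /eqP H5] := H3 _ (io j); split.
  rewrite (eq_bigr (fun l : 'I_k => ((tadj tA i l : nat)%:Z * entry M l j)%:~R / d%:~R)); last first.
    by move=> l _; rewrite intrM -mulrA.
  rewrite [RHS](eq_bigr (fun l : 'I_k => (entry M i l * (tadj tB l j : nat)%:Z)%:~R / d%:~R)); last first.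
    by move=> l _; rewrite (mE _ (_, _)).
  rewrite -[LHS]mulr_suml -[RHS]mulr_suml; congr (_ / _).
  by rewrite -[LHS](rmorph_sum intr) -[RHS](rmorph_sum intr); rewrite -!isumE in H4; rewrite H4.
rewrite (eq_bigr (fun l : 'I_k => (entry M i l * entry M j l)%:~R / d%:~R / d%:~R)); last first.
  by move=> l _; rewrite intrM /m mulf_div invfM mulrA.
rewrite -isumE in H5.
transitivity ((\sum_(l < k) entry M i l * entry M j l)%:~R / d%:~R / d%:~R : algC).
  by rewrite rmorph_sum !mulr_suml.
rewrite H5 !intrM.
by rewrite -mulrA -invfM mulrAC mulfV ?mul1r ?mulf_neq0.
Qed.

(** The block matrix diag(1, M / d), the identity outside the tree. *)
Definition rotation_fun (x z : T) : algC :=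
  match [pick i | f i == x], [pick j | f j == z] with
  | Some i, Some j => m i j
  | None, None => (x == z)%:R
  | _, _ => 0
  end.

Local Notation P := rotation_fun.

Lemma sum_hung (F : T -> algC) :
  \sum_y F y = \sum_(y | y \notin S) F y + \sum_(i < k) F (f i).
Proof.
rewrite (bigID (mem S)) /= addrC; congr (_ + _).
by rewrite big_imset /=; [apply: eq_bigl => i; rewrite inE|move=> a b _ _; apply: finj].
Qed.

Lemma rotation_in i j : P (f i) (f j) = m i j.
Proof. by rewrite /P !pick_hung. Qed.
Lemma rotation_inout i z : z \notin S -> P (f i) z = 0.
Proof. by move=> zS; rewrite /P pick_hung // pick_nhung. Qed.
Lemma rotation_outin i z : z \notin S -> P z (f i) = 0.
Proof. by move=> zS; rewrite /P pick_hung // pick_nhung. Qed.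
Lemma rotation_out x z : x \notin S -> z \notin S -> P x z = (x == z)%:R.
Proof. by move=> xS zS; rewrite /P !pick_nhung. Qed.

Lemma sum_delta_l (Q : pred T) (F : T -> algC) x : Q x ->
  \sum_(y | Q y) (x == y)%:R * F y = F x.
Proof.
move=> Qx; rewrite (bigD1 x) //= eqxx mul1r big1 ?addr0 // => y /andP[_ yx].
by rewrite eq_sym (negbTE yx) mul0r.
Qed.

Lemma sum_delta_r (Q : pred T) (F : T -> algC) x : Q x ->
  \sum_(y | Q y) F y * (y == x)%:R = F x.
Proof.
by move=> Qx; rewrite -[RHS](sum_delta_l F Qx); apply: eq_bigr => y _; rewrite mulrC eq_sym.
Qed.

(** Four blocks: inside the tree the two trees are intertwined, the mixed blocks are the exchange of
    the attachment vectors, and outside nothing changes. *)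
Lemma rotation_intertwines x z :
  \sum_y (e x y)%:R * P y z = \sum_y P x y * (hang f u tB e y z)%:R.
Proof.
rewrite !sum_hung; case: (boolP (x \in S)) => [/hungP[i ->]|xS];
  case: (boolP (z \in S)) => [/hungP[j ->]|zS].
- rewrite big1 => [|y yS]; last by rewrite rotation_outin ?mulr0.
  rewrite [X in _ = X + _]big1 => [|y yS]; last by rewrite rotation_inout ?mul0r.
  rewrite !add0r; have [_ _ /(_ j)[H _]] := rotP i.
  under eq_bigr => l _ do rewrite (attached_in finj fu i l at_e) rotation_in.
  by rewrite H; apply: eq_bigr => l _; rewrite rotation_in hang_in.
- rewrite [X in _ = X + _]big1 => [|y yS]; last by rewrite rotation_inout ?mul0r.
  rewrite [X in _ + X = _]big1 => [|l _]; last by rewrite rotation_inout ?mulr0.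
  rewrite add0r addr0 (eq_bigr (fun y => (e (f i) y)%:R * (y == z)%:R)) => [|y yS]; last by rewrite rotation_out.
  rewrite sum_delta_r // (attached_out _ at_e zS).
  rewrite (eq_bigr (fun l : 'I_k => m i l * (troot tB l)%:R * (z == u)%:R)) => [|l _]; last first.
    by rewrite rotation_in hang_inout // andbC -mulrA -natrM mulnb.
  by rewrite -mulr_suml; have [-> _ _] := rotP i; rewrite -natrM mulnb andbC.
- rewrite big1 => [|y yS]; last by rewrite rotation_outin ?mulr0.
  rewrite [X in _ = _ + X]big1 => [|l _]; last by rewrite rotation_outin ?mul0r.
  rewrite add0r addr0 [RHS](eq_bigr (fun y => (x == y)%:R * (hang f u tB e y (f j))%:R)) => [|y yS]; last by rewrite rotation_out.
  rewrite sum_delta_l // hang_outin //.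
  rewrite (eq_bigr (fun l : 'I_k => (x == u)%:R * ((troot tA l)%:R * m l j))) => [|l _]; last first.
    by rewrite rotation_in es (attached_out _ at_e xS) mulrA -natrM mulnb.
  by rewrite -mulr_sumr; have [_ -> _] := rotP j; rewrite -natrM mulnb.
rewrite [X in _ + X = _]big1 => [|l _]; last by rewrite rotation_inout ?mulr0.
rewrite [X in _ = _ + X]big1 => [|l _]; last by rewrite rotation_outin ?mul0r.
rewrite !addr0 (eq_bigr (fun y => (e x y)%:R * (y == z)%:R)) => [|y yS]; last by rewrite rotation_out.
rewrite [RHS](eq_bigr (fun y => (x == y)%:R * (hang f u tB e y z)%:R)) => [|y yS]; last by rewrite rotation_out.
by rewrite sum_delta_l // sum_delta_r // hang_out.
Qed.

Lemma rotation_orthogonal x z : \sum_y P x y * P z y = (x == z)%:R.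
Proof.
rewrite !sum_hung; case: (boolP (x \in S)) => [/hungP[i ->]|xS];
  case: (boolP (z \in S)) => [/hungP[j ->]|zS].
- rewrite big1 => [|y yS]; last by rewrite rotation_inout ?mul0r.
  rewrite add0r (inj_eq finj); have [_ _ /(_ j)[_ <-]] := rotP i.
  by apply: eq_bigr => l _; rewrite !rotation_in.
- rewrite !big1 ?addr0 => [|l _|y yS]; last 2 first.
  + by rewrite [P z _]rotation_outin ?mulr0.
  + by rewrite rotation_inout ?mul0r.
  by case: eqP => // E; rewrite -E mem_hung in zS.
- rewrite !big1 ?addr0 => [|l _|y yS]; last 2 first.
  + by rewrite rotation_outin ?mul0r.
  + by rewrite [P (f j) _]rotation_inout ?mulr0.
  by case: eqP => // E; rewrite E mem_hung in xS.
rewrite [X in _ + X = _]big1 => [|l _]; last by rewrite rotation_outin ?mul0r.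
rewrite addr0 (eq_bigr (fun y => (x == y)%:R * (z == y)%:R)) => [|y yS]; last by rewrite !rotation_out.
by rewrite sum_delta_l // eq_sym.
Qed.

Lemma rotation_sums : stochastic k M d ->
  (forall x, \sum_y P x y = 1) /\ (forall z, \sum_y P y z = 1).
Proof.
move=> /allP st; have io (j : 'I_k) : val j \in iota 0 k by rewrite mem_iota /=.
split=> x; rewrite sum_hung; case: (boolP (x \in S)) => [/hungP[i ->]|xS].
- have /andP[/eqP H _] := st _ (io i).
  rewrite big1 ?add0r => [|y yS]; last by rewrite rotation_inout.
  under eq_bigr => l _ do rewrite rotation_in.
  by rewrite (@m_isum (entry M i) 1) ?mulr1.
- rewrite [X in _ + X = _]big1 ?addr0 => [|l _]; last by rewrite rotation_outin.
  rewrite (eq_bigr (fun y => (x == y)%:R * 1)) => [|y yS]; last by rewrite rotation_out ?mulr1.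
  by rewrite sum_delta_l.
- have /andP[_ /eqP H] := st _ (io i).
  rewrite big1 ?add0r => [|y yS]; last by rewrite rotation_outin.
  under eq_bigr => l _ do rewrite rotation_in.
  by rewrite (@m_isum (fun l => entry M l i) 1) ?mulr1.
rewrite [X in _ + X = _]big1 ?addr0 => [|l _]; last by rewrite rotation_inout.
rewrite (eq_bigr (fun y => 1 * (y == x)%:R)) => [|y yS]; last by rewrite rotation_out ?mul1r.
by rewrite sum_delta_r.
Qed.

End Rotation.

(** Two children of each root, with one neighbour outside, give the root degree at least 3 in both
    graphs; the walk counts then separate them. *)
Definition limb_pair (k : nat) (tA tB : seq nat) (M : seq (seq int)) (d : int) : bool :=
  [&& rotation k tA tB M d, (2 <= nsum k (fun i => troot tA i))%N,
      (2 <= nsum k (fun i => troot tB i))%N & ntail_walks k tA != ntail_walks k tB].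

(** * Mates of the giant component *)

Section GiantMate.
Variables (n : nat) (w : {ffun upair n -> bool}) (tA tB : seq nat) (M : seq (seq int)) (d : int).
Hypotheses (wfA : wf_tree tA) (wfB : wf_tree tB) (sAB : size tA = size tB).
Hypothesis pair : limb_pair (size tA) tA tB M d.
Hypothesis giant : limbed_giant tA w.

Lemma giant_mate : giant_has_mate (gnp_graph w).
Proof.
move=> C largest; have [Cbig [f [u L uC]]] := giant largest.
have [es ei] := (@gnp_graph_sym _ w, @gnp_graph_irr _ w).
have [f' [u' [finj fu at_e [y [yS uy uny]]]]] :=
  induced_limb es ei wfA L largest.1 uC Cbig.
case/and4P: pair => rot rA rB wAB.
have es' : symmetric (Defs.induced (gnp_graph w) (C := C)) by move=> a b; apply: es.
have ei' : irreflexive (Defs.induced (gnp_graph w) (C := C)) by move=> a; apply: ei.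
apply: (@mate_intro _ _ (hang f' u' tB (@Defs.induced _ (gnp_graph w) C))).
- by split; [apply: hang_sym|apply: hang_irr].
- exact: (hang_not_iso finj fu es' at_e yS uy uny).
apply: (cospectral_intertwined _ (rotation_intertwines finj fu es' rot at_e)
   (rotation_orthogonal finj rot)) => //.
Qed.

Lemma giant_Rmate : stochastic (size tA) M d -> giant_has_Rmate (gnp_graph w).
Proof.
move=> st C largest; have [Cbig [f [u L uC]]] := giant largest.
have [es ei] := (@gnp_graph_sym _ w, @gnp_graph_irr _ w).
have [f' [u' [finj fu at_e [y [yS uy uny]]]]] :=
  induced_limb es ei wfA L largest.1 uC Cbig.
case/and4P: pair => rot rA rB wAB.
have es' : symmetric (Defs.induced (gnp_graph w) (C := C)) by move=> a b; apply: es.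
have ei' : irreflexive (Defs.induced (gnp_graph w) (C := C)) by move=> a; apply: ei.
have [P1 P2] := rotation_sums finj rot st.
apply: (@Rmate_intro _ _ (hang f' u' tB (@Defs.induced _ (gnp_graph w) C))).
- by split; [apply: hang_sym|apply: hang_irr].
- exact: (hang_not_iso finj fu es' at_e yS uy uny).
- apply: (cospectral_intertwined _ (rotation_intertwines finj fu es' rot at_e)
   (rotation_orthogonal finj rot)) => //.
apply: (cospectral_gcompl ei' _ (rotation_intertwines finj fu es' rot at_e)
   (rotation_orthogonal finj rot)) => //.
exact: hang_irr.
Qed.

End GiantMate.

(* Schwenk's 9-vertex tree, rooted at its two cospectral vertices. *)
Definition schwenkA : seq nat := [:: 0; 1; 2; 3; 2; 0; 6; 7]%N.
Definition schwenkB : seq nat := [:: 0; 1; 2; 3; 4; 5; 1; 0]%N.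
Definition schwenkM : seq (seq int) := [::
  [:: 2; -1; 0; 1; 2; -1; 1; 2];
  [:: 0; 2; 0; 2; 0; 2; 2; 0];
  [:: 0; 0; 4; 0; 0; 0; 0; 0];
  [:: 0; 2; 0; 2; 0; -2; -2; 0];
  [:: 2; 1; 0; -1; 2; 1; -1; -2];
  [:: 2; 1; 0; -1; -2; 1; -1; 2];
  [:: 0; 2; 0; -2; 0; -2; 2; 0];
  [:: 2; -1; 0; 1; -2; -1; 1; -2]]%Z.

(* Found by comparing, over all 11-vertex rooted trees, the spectra and the walk counts
   between the attachment and all-ones vectors. *)
Definition rcospectralA : seq nat := [:: 0; 1; 2; 3; 4; 4; 1; 0; 8; 9]%N.
Definition rcospectralB : seq nat := [:: 0; 1; 2; 3; 4; 5; 2; 0; 8; 8]%N.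
Definition rcospectralM : seq (seq int) := [::
  [:: 3; 2; 0; -2; 1; -2; 3; 4; -1; -1];
  [:: 1; 3; 0; 4; -2; -3; 1; -1; 2; 2];
  [:: 0; 0; 7; 0; 0; 0; 0; 0; 0; 0];
  [:: -1; 4; 0; 3; 2; 3; -1; 1; -2; -2];
  [:: 2; -1; 0; 1; 3; 1; 2; -2; 4; -3];
  [:: 2; -1; 0; 1; 3; 1; 2; -2; -3; 4];
  [:: 1; 3; 0; -3; -2; 4; 1; -1; 2; 2];
  [:: 4; -2; 0; 2; -1; 2; -3; 3; 1; 1];
  [:: -2; 1; 0; -1; 4; -1; -2; 2; 3; 3];
  [:: -3; -2; 0; 2; -1; 2; 4; 3; 1; 1]]%Z.

Lemma schwenk_pair : limb_pair 8 schwenkA schwenkB schwenkM 4.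
Proof. by vm_compute. Qed.

Lemma rcospectral_pair : limb_pair 10 rcospectralA rcospectralB rcospectralM 7.
Proof. by vm_compute. Qed.

Lemma rcospectral_stochastic : stochastic 10 rcospectralM 7.
Proof. by vm_compute. Qed.

(** * Passing to the limit *)

Local Open Scope classical_set_scope.

Lemma limb_whp (R : realType) (lam h : nat -> R) (t : seq nat)
    (P : forall n, rel 'I_n -> Prop) :
  wf_tree t -> (0 < size t)%N ->
  (exists c : R, 1 < c /\ \forall n \near \oo, c <= lam n) ->
  h n @[n --> \oo] --> +oo ->
  (\forall n \near \oo,
     lam n <= ln (n%:R : R) / (size t)%:R + ln (ln (n%:R : R)) - h n) ->
  (forall n (w : {ffun upair n -> bool}), limbed_giant t w -> P n (gnp_graph w)) ->
  gnp_prob (lam n / n%:R) (P n) @[n --> \oo] --> (1 : R).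
Proof.
move=> wft t0 [c [c1 clam]] hoo lamL HP; apply/cvgrPdist_le => eps eps0.
have [A AP] := limb_whp_aux wft t0 c1 eps0.
near=> n.
have /andP[lo hi] : 1 - eps <= gnp_prob (lam n / n%:R) (P n) <= 1.
  apply: (AP n (lam n) (h n)) => //; last exact: HP.
  (* It suffices that n exceeds e^A. *)
  - rewrite -[A]expRK ler_ln ?posrE ?expR_gt0 //.
      by apply: ltW; near: n; apply: nbhs_infty_gtr.
    apply: lt_trans (expR_gt0 A) _; near: n; exact: nbhs_infty_gtr.
  - by near: n; move/cvgryPge: hoo; apply.
  - by near: n.
  - by near: n.
by rewrite ger0_norm; lra.
Unshelve. all: by end_near.
Qed.

Theorem theorem1p1 (R : realType) (lam h : nat -> R) :
  (forall n, 1 < lam n) ->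
  (exists c : R, 1 < c /\ \forall n \near \oo, c <= lam n) ->
  h n @[n --> \oo] --> +oo ->
  ((\forall n \near \oo,
       lam n <= ln (n%:R : R) / 8 + ln (ln (n%:R : R)) - h n) ->
     gnp_prob (lam n / n%:R) (@giant_has_mate n) @[n --> \oo] --> (1 : R))
  /\
  ((\forall n \near \oo,
       lam n <= ln (n%:R : R) / 10 + ln (ln (n%:R : R)) - h n) ->
     gnp_prob (lam n / n%:R) (@giant_has_Rmate n) @[n --> \oo] --> (1 : R)).
Proof.
move=> _ clam hoo; split=> lamL.
  have wfA : wf_tree schwenkA by rewrite wf_treeE.
  have wfB : wf_tree schwenkB by rewrite wf_treeE.
  apply: (limb_whp wfA _ clam hoo lamL) => // n w; exact: giant_mate wfA wfB _ schwenk_pair.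
have wfA : wf_tree rcospectralA by rewrite wf_treeE.
have wfB : wf_tree rcospectralB by rewrite wf_treeE.
apply: (limb_whp wfA _ clam hoo lamL) => // n w L.
exact: (giant_Rmate wfA wfB _ rcospectral_pair L rcospectral_stochastic).
Qed.
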